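(* Let $k$ be a positive integer, and let $G$ be a graph with minimum degree $\delta\ge 2k+2$ and order $n\ge 2\delta+3$. If $\lambda_1(G)\ge \lambda_1(B_{n,\delta+1}^{k-1})$, then $G$ has property $P(k,\delta)$ unless $G\cong B_{n,\delta+1}^{k-1}$.
   Context: All graphs are finite, undirected and simple. The order of a graph is its number of vertices. The eigenvalues of a graph $G$ of order $n$ are the eigenvalues of its adjacency matrix, and $\lambda_i(G)$ denotes the $i$-th largest one ($i=1,\dots,n$, counted with multiplicity); $\lambda_1(G)$ is the spectral radius. For positive integers $n$ and $s$ and a nonnegative integer $m$ with $n\ge s+m$, $B_{n,s}^{m}$ denotes the graph obtained from vertex-disjoint complete graphs $K_s$ and $K_{n-s}$ by adding $m$ edges joining one (fixed) vertex of $K_s$ to $m$ distinct vertices of $K_{n-s}$. In particular $B_{n,s}^{0}=K_s\cup K_{n-s}$ (disjoint union). For a connected graph $G$, $\tau(G)$ is the maximum number of pairwise edge-disjoint spanning trees in $G$ (with $\tau(K_1)=\infty$), and $\tau(G)=0$ if $G$ is disconnected. For a nonnegative integer $k$ and a positive integer $d$, a graph $G$ has property $P(k,d)$ if: (a) $\tau(G)\ge k$; (b) apart from $k$ edge-disjoint spanning trees of $G$, there is another forest $F$ in $G$ (edge-disjoint from these $k$ spanning trees) with $|E(F)|>\frac{d-1}{d}(|V(G)|-1)$; and (c) if this $F$ is not a spanning tree of $G$, then $F$ has a component with at least $d$ edges. (That is, there exist $k$ pairwise edge-disjoint spanning trees and a forest $F$ edge-disjoint from all of them such that $F$ satisfies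 both the conditions in (b) and (c).) *)

(* Defs.v *)
From mathcomp Require Import all_boot all_order all_algebra.
From mathcomp Require Import polyrcf reals.

Set Implicit Arguments.
Unset Strict Implicit.
Unset Printing Implicit Defensive.

Import Order.TTheory GRing.Theory Num.Theory.

Local Open Scope ring_scope.

(** * Finite simple graphs *)

Record sgraph := SGraph {
  vertex :> finType;
  adj : rel vertex;
  adj_sym : symmetric adj;
  adj_irrefl : irreflexive adj }.

Definition edges (G : sgraph) : {set {set G}} :=
  [set e | [exists x, exists y, adj x y && (e == [set x; y])]].

Definition degree (G : sgraph) (x : G) : nat := #|[set y | adj x y]|.

(* The default value #|G| is larger than every degree when G is nonempty. *)
Definition min_degree (G : sgraph) : nat :=
  (\big[minn/#|G|]_(x : G) degree x)%N.

Definition isomorphic (G H : sgraph) : Prop :=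
  exists f : G -> H, bijective f /\ forall x y, adj (f x) (f y) = adj x y.

(** * Eigenvalues *)

Definition adj_matrix (R : realType) (G : sgraph) : 'M[R]_#|G| :=
  \matrix_(i, j) (adj (enum_val i) (enum_val j))%:R.

(* Real eigenvalues in decreasing order, each repeated according to its
   algebraic multiplicity; [rootsR] lists the distinct real roots in increasing
   order. As the matrix is symmetric, these are all its eigenvalues. *)
Definition eigenvalues (R : realType) (G : sgraph) : seq R :=
  let p := char_poly (adj_matrix R G) in
  rev (flatten [seq nseq (mup x p) x | x <- rootsR p]).

(* The index i starts at 1. *)
Definition lambda (R : realType) (i : nat) (G : sgraph) : R :=
  nth 0 (eigenvalues R G) i.-1.

(** * The graphs B_{n,s}^m *)

(* K_s lives on the vertices 0, ..., s-1 and K_{n-s} on s, ..., n-1; vertex 0 is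
   moreover joined to s, ..., s+m-1. Meaningful for 0 < s and s + m <= n. *)
Definition B_adj (n s m : nat) : rel 'I_n := fun i j =>
  (i != j) &&
  [|| (i < s)%N == (j < s)%N,
      (i == 0 :> nat) && (s <= j < s + m)%N |
      (j == 0 :> nat) && (s <= i < s + m)%N].

Lemma B_adj_sym n s m : symmetric (@B_adj n s m).
Proof.
by move=> i j; rewrite /B_adj eq_sym [(i < s)%N == _]eq_sym; congr (_ && (_ || _)); rewrite orbC.
Qed.

Lemma B_adj_irrefl n s m : irreflexive (@B_adj n s m).
Proof. by move=> i; rewrite /B_adj eqxx. Qed.

Definition B_graph (n s m : nat) : sgraph :=
  SGraph (@B_adj_sym n s m) (@B_adj_irrefl n s m).

(** * Spanning trees, forests and the property P(k,d) *)

(* A set F of edges of G is identified with the spanning subgraph (V(G), F). *)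
Definition edge_rel (G : sgraph) (F : {set {set G}}) : rel G :=
  fun x y => [set x; y] \in F.

Definition acyclic (G : sgraph) (F : {set {set G}}) : Prop :=
  forall c : seq G, (2 < size c)%N -> uniq c -> ~~ cycle (edge_rel F) c.

Definition is_forest (G : sgraph) (F : {set {set G}}) : Prop :=
  F \subset edges G /\ acyclic F.

Definition is_spanning_tree (G : sgraph) (F : {set {set G}}) : Prop :=
  is_forest F /\ forall x y : G, connect (edge_rel F) x y.

(* The edges of F in the component of (V(G), F) containing x. *)
Definition component_edges (G : sgraph) (F : {set {set G}}) (x : G) :
  {set {set G}} :=
  [set e in F | e \subset [set y | connect (edge_rel F) x y]].

Definition property_P (k d : nat) (G : sgraph) : Prop :=
  exists (T : 'I_k -> {set {set G}}) (F : {set {set G}}),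
    (forall i, is_spanning_tree (T i)) /\
    (forall i j, i != j -> [disjoint T i & T j]) /\
    is_forest F /\
    (forall i, [disjoint F & T i]) /\
    (d%:R - 1) / d%:R * (#|G|%:R - 1) < #|F|%:R :> rat /\
    (~ is_spanning_tree F -> exists x : G, (d <= #|component_edges F x|)%N).

(* Main.v *)
Require Import Defs.
From mathcomp Require Import all_boot all_order all_algebra.
From mathcomp Require Import polyrcf reals zify lra ring.

(* Suppose G violates P(k, delta). Matroid union for k + 1 copies of the graphic
   matroid yields either k + 1 disjoint forests with at least (k + 1)(n - 1) - 1
   edges in total, hence k spanning trees and a forest missing at most one edge
   of a spanning tree, or a partition into t classes with fewer than
   (k + 1)(t - 1) - 1 crossing edges. A class of at most delta vertices is left
   by at least delta >= 2(k + 1) edges, so two classes have more than delta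
   vertices; and for t >= 3 the edge bound of Hong, Shu and Fang leaves too many
   crossing edges. So t = 2, with at most k - 1 crossing edges.

   The spectral radius is then bounded by explicit positive vectors z with
   A z <= rho z. If both sides have at least delta + 2 vertices, a vertex
   incident to c of the m crossing edges gets weight m + 1 + c, which gives
   rho < n - delta - 2. If one side has delta + 1 vertices, z imitates the Perron
   vector of B_{n,delta+1}^{k-1}, with rho its spectral radius, and equality
   forces G to be that graph. *)

Set Implicit Arguments.
Unset Strict Implicit.
Unset Printing Implicit Defensive.

Import Order.TTheory GRing.Theory Num.Theory.

Local Open Scope nat_scope.

(** * Forests and components *)

(** Upper bounds on the spectral radius come from one pairing: for [x >= 0] with [lam x <= A x] and
    [z > 0] with [A z <= rho z], the number [x^T A z] lies between [lam x^T z] and [rho x^T z].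
    Tightness also reveals which edges are present, but only around the support of [x], so
    positivity has to be carried along edges. Of the spectral radius of [B_{n,s}^m] only a lower
    bound matters, and an explicit eigenvector gives it; both graphs are thus compared with the same
    number [r - 1], where [r] is a root of a quartic. The value [n - delta - 2] is the spectral
    radius of the larger clique of [B_{n,delta+1}^{k-1}]. The obstacle in the last case is that the
    pattern of the crossing edges is unknown. Only three numbers describe it in [z]: the number of
    edges, the number of their ends outside [A], and the sum of the squared crossing degrees there.
    One missing edge is harmless for [F]: [n - 2] still exceeds the required bound, and one of two
    components must have more than [delta] vertices. *)

Section Forests.
Variable G : sgraph.
Implicit Types (F : {set {set G}}) (x y u v a b : G).

Local Notation cn F := (connect (edge_rel F)).
Local Notation rt F := (fingraph.root (edge_rel F)).

Lemma set2_eq (T : finType) (a b x y : T) :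
  [set a; b] = [set x; y] -> (a = x /\ b = y) \/ (a = y /\ b = x).
Proof.
move=> E.
have : a \in [set x; y] by rewrite -E set21.
have : b \in [set x; y] by rewrite -E set22.
have : x \in [set a; b] by rewrite E set21.
have : y \in [set a; b] by rewrite E set22.
rewrite !inE.
by do 4![case/orP=> /eqP ?]; subst; auto.
Qed.

Lemma edge_rel_sym F : symmetric (edge_rel F).
Proof. by move=> x y; rewrite /edge_rel setUC. Qed.

Lemma cn_sym F : connect_sym (edge_rel F).
Proof. exact/sym_connect_sym/edge_rel_sym. Qed.

Lemma edgesP F e : F \subset edges G -> e \in F ->
  exists x y, e = [set x; y] /\ adj x y.
Proof.
move=> /subsetP sF /sF; rewrite inE => /existsP[x /existsP[y /andP[axy /eqP ->]]].
by exists x, y.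
Qed.

Lemma adj_neq x y : adj x y -> x != y.
Proof. by apply: contraTneq => ->; rewrite adj_irrefl. Qed.

Lemma mem_edges x y : ([set x; y] \in edges G) = adj x y.
Proof.
rewrite inE; apply/existsP/idP => [[a /existsP[b /andP[ab /eqP]]]|xy].
  by case/set2_eq=> [] [-> ->] //; rewrite adj_sym.
by exists x; apply/existsP; exists y; rewrite xy eqxx.
Qed.

Lemma cn_mono F F' : F \subset F' -> subrel (cn F) (cn F').
Proof.
move=> /subsetP sF; apply: connect_sub => x y xy.
by apply/connect1/sF.
Qed.

Lemma connect_setU1 F x y a b : cn ([set x; y] |: F) a b ->
  [|| cn F a b, cn F a x && cn F y b | cn F a y && cn F x b].
Proof.
case/connectP=> p; elim: p a => [|c p IHp] a /=; first by move=> _ ->; rewrite connect0.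
case/andP=> ac /IHp{}IHp /IHp.
move: ac; rewrite {1}/edge_rel !inE => /orP[/eqP/set2_eq[] [-> ->]|acF].
- by case/or3P=> [->|/andP[_ ->]|/andP[_ ->]]; rewrite connect0 ?orbT.
- by case/or3P=> [->|/andP[_ ->]|/andP[_ ->]]; rewrite connect0 ?orbT.
have ac : cn F a c by apply: connect1.
case/or3P=> [cb|/andP[cx ->]|/andP[cy ->]].
- by rewrite (connect_trans ac cb).
- by rewrite (connect_trans ac cx) !orbT.
- by rewrite (connect_trans ac cy) !orbT.
Qed.

(** Acyclicity quantifies over all sequences; this form is boolean, so that a maximum packing can be
    picked in a finite type, and it speaks of one edge at a time, which suits exchanges. *)
Definition all_bridges F :=
  [forall u, forall v, (u != v) ==> ([set u; v] \in F) ==>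
     ~~ cn (F :\ [set u; v]) u v].

Lemma all_bridgesP F :
  reflect (forall u v, u != v -> [set u; v] \in F -> ~~ cn (F :\ [set u; v]) u v)
          (all_bridges F).
Proof.
apply: (iffP 'forall_forallP) => H u v; first by move=> uv uvF; move/implyP/(_ uv)/implyP/(_ uvF): (H u v).
by apply/implyP=> uv; apply/implyP; apply: H.
Qed.

Lemma acyclicP F : acyclic F <-> all_bridges F.
Proof.
split=> [acF|/all_bridgesP brF c].
  apply/all_bridgesP=> u v uv uvF; apply/negP=> /connectP[p0 pth0 ev].
  case/shortenP: pth0 ev => p pth up _ ev.
  (* A path of length one would be the deleted edge itself. *)
  have szp : 1 < size p.
    case: p pth up ev => [|w [|w' p]] //=; first by move=> _ _ ev; rewrite ev eqxx in uv.
    by move=> /andP[uw _] _ ev; move: uw; rewrite -ev /edge_rel !inE eqxx.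
  have /negP[] := acF (u :: p) szp up.
  rewrite /= rcons_path -ev /edge_rel [[set v; u]]setUC uvF andbT.
  by apply: sub_path pth => a b; rewrite /edge_rel inE => /andP[].
case: c => [|u [|v [|w p]]] // _ /= /andP[]; rewrite !inE !negb_or.
case/and3P=> uv uw up /andP[/andP[vw vp] _]; apply/negP.
case/and3P=> uvF vwF; rewrite rcons_path => /andP[pth lu].
have /negP[] := brF u v uv uvF.
set F' := _ :\ _.
have av a : a != u -> a != v -> forall b, edge_rel F a b -> edge_rel F' a b.
  move=> au av b ab; rewrite /edge_rel !inE; apply/andP; split=> //.
  by apply/eqP=> /set2_eq[] [E _]; rewrite E eqxx in au av.
have wl : cn F' w (last w p).
  apply/connectP; exists p => //.
  have avin : {in predC (pred2 u v) &, subrel (edge_rel F) (edge_rel F')}.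
    by move=> a b; rewrite !inE negb_or => /andP[au av'] _; apply: av.
  apply: (sub_in_path avin) pth.
  apply/allP=> a; rewrite inE => /predU1P[->|ap] ; rewrite inE /= negb_or.
    by rewrite ![w == _]eq_sym uw vw.
  by rewrite (memPn up) ?(memPn vp).
have wv : cn F' w v.
  by apply/connect1/av; rewrite ?[w == _]eq_sym // edge_rel_sym.
have lu' : cn F' (last w p) u.
  apply/connect1/av => //.
    case/lastP: p up {lu vp pth wl} => [|p z]; first by rewrite eq_sym.
    by rewrite last_rcons mem_rcons inE negb_or eq_sym => /andP[].
  case/lastP: p vp {lu up pth wl} => [|p z]; first by rewrite eq_sym.
  by rewrite last_rcons mem_rcons inE negb_or eq_sym => /andP[].
by rewrite cn_sym; apply: connect_trans lu'; apply: connect_trans wl; rewrite cn_sym.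
Qed.

Lemma all_bridges_sub F F' : F' \subset F -> all_bridges F -> all_bridges F'.
Proof.
move=> sF /all_bridgesP brF; apply/all_bridgesP=> u v uv uvF'.
apply: contra (brF u v uv (subsetP sF _ uvF')).
exact/cn_mono/setSD.
Qed.

Lemma all_bridgesU1 F x y : all_bridges F -> ~~ cn F x y ->
  all_bridges ([set x; y] |: F).
Proof.
move=> /all_bridgesP brF nxy.
have xyF : [set x; y] \notin F by apply: contra nxy; apply: connect1.
apply/all_bridgesP=> u v uv; rewrite !inE; case: eqP => [E _|ne /= uvF].
  have -> : ([set x; y] |: F) :\ [set u; v] = F by rewrite E setU1K.
  by case/set2_eq: E => [] [-> ->] //; rewrite cn_sym.
have sF : F :\ [set u; v] \subset F by rewrite subsetDl.
have cuv : cn F u v by apply: connect1.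
have -> : ([set x; y] |: F) :\ [set u; v] = [set x; y] |: (F :\ [set u; v]).
  apply/setP=> e; rewrite !inE; case: (e =P [set x; y]) => [->|//].
  by rewrite andbT /=; apply/eqP=> E; apply: ne.
apply/negP=> /connect_setU1/or3P[|/andP[ux yv]|/andP[uy xv]].
- exact/negP/brF.
- case/negP: nxy; apply: connect_trans (connect_trans cuv _).
    by rewrite cn_sym (cn_mono sF).
  by rewrite cn_sym (cn_mono sF).
- case/negP: nxy; rewrite cn_sym; apply: connect_trans (connect_trans cuv _).
    by rewrite cn_sym (cn_mono sF).
  by rewrite cn_sym (cn_mono sF).
Qed.

Definition comps F := #|rt F @: [set: G]|.

Lemma same_root F x y : (rt F x == rt F y) = cn F x y.
Proof. exact/root_connect/cn_sym. Qed.

Lemma root_idem F x : rt F (rt F x) = rt F x.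
Proof. exact/root_root/cn_sym. Qed.

(** Stated for connectivity instead of inclusion: it is applied where a set loses edges but no
    connections. *)
Lemma comps_le F F' : subrel (cn F) (cn F') -> comps F' <= comps F.
Proof.
move=> sF; apply: leq_trans (leq_imset_card (rt F') _).
apply/subset_leq_card/subsetP=> _ /imsetP[x _ ->].
have -> : rt F' x = rt F' (rt F x).
  by apply/eqP; rewrite same_root; apply/sF/connect_root.
exact/imset_f/imset_f.
Qed.

Lemma compsU1 F x y : ~~ cn F x y -> comps F = (comps ([set x; y] |: F)).+1.
Proof.
move=> nxy; set F' := _ |: F.
have sF : subrel (cn F) (cn F') by apply/cn_mono/subsetUr.
have cxy : cn F' x y by apply/connect1; rewrite /edge_rel setU11.
pose r := rt F; pose r' := rt F'.
rewrite /comps (cardsD1 (r y)) imset_f //= add1n; congr _.+1.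
have -> : r' @: [set: G] = r' @: ((r @: [set: G]) :\ r y).
  apply/eqP; rewrite eqEsubset [X in _ && X]imsetS // andbT.
  apply/subsetP=> _ /imsetP[z _ ->].
  have [zy|zy] := eqVneq (r z) (r y).
    apply/imsetP; exists (r x); first by rewrite !inE same_root nxy imset_f.
    apply/eqP; rewrite same_root; move/eqP: zy; rewrite same_root => /sF zy.
    apply: connect_trans zy _; rewrite cn_sym in cxy.
    exact: connect_trans cxy (sF _ _ (connect_root _ _)).
  apply/imsetP; exists (r z); first by rewrite !inE zy imset_f.
  by apply/eqP; rewrite same_root; apply/sF/connect_root.
rewrite card_in_imset // => a b; rewrite !inE.
move=> /andP[ay /imsetP[a0 _ Ea]] /andP[b_y /imsetP[b0 _ Eb]] /eqP; rewrite same_root.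
have ra : r a = a by rewrite Ea; apply: root_idem.
have rb : r b = b by rewrite Eb; apply: root_idem.
case/connect_setU1/or3P => [|/andP[_]|/andP[+ _]].
- by rewrite -same_root -/r => /eqP; rewrite /r -/r ra rb.
- by rewrite -same_root => /eqP E; rewrite -rb /r -E eqxx in b_y.
- by rewrite -same_root => /eqP E; rewrite -ra /r E eqxx in ay.
Qed.

Lemma comps0 : comps set0 = #|G|.
Proof.
rewrite /comps card_in_imset ?cardsT // => x y _ _ /eqP; rewrite same_root.
by case/connectP=> [[|z p]] //=; rewrite /edge_rel inE.
Qed.

Lemma card_forest F : is_forest F -> #|F| + comps F = #|G|.
Proof.
move=> [sF /acyclicP brF].
move: {2}#|F| (erefl #|F|) => c; elim: c => [|c IHc] in F sF brF *.
  by move=> /cards0_eq ->; rewrite cards0 comps0.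
move=> cF; have /set0Pn[e eF] : F != set0 by rewrite -cards_eq0 cF.
have [x [y [Ee xy]]] := edgesP sF eF.
have nxy : ~~ cn (F :\ e) x y.
  by rewrite Ee; move/all_bridgesP: brF; apply; rewrite -?Ee ?adj_neq.
have := compsU1 nxy; rewrite -Ee setD1K // => Ec.
have cF' : #|F :\ e| = c by have := cardsD1 e F; rewrite eF cF; lia.
have sFe : F :\ e \subset F by rewrite subsetDl.
have := IHc _ (subset_trans sFe sF) (all_bridges_sub sFe brF) cF'.
by rewrite cF Ec cF'; lia.
Qed.

Lemma card_le_comps F : F \subset edges G -> #|G| <= #|F| + comps F.
Proof.
move=> sF; move: {2}#|F| (erefl #|F|) => c; elim: c => [|c IHc] in F sF *.
  by move=> /cards0_eq ->; rewrite cards0 comps0.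
move=> cF; have /set0Pn[e eF] : F != set0 by rewrite -cards_eq0 cF.
have [x [y [Ee xy]]] := edgesP sF eF.
have cF' : #|F :\ e| = c by have := cardsD1 e F; rewrite eF cF; lia.
have := IHc _ (subset_trans (subsetDl _ _) sF) cF'.
have [cxy|nxy] := boolP (cn (F :\ e) x y); last first.
  by have := compsU1 nxy; rewrite -Ee setD1K // => Ec; lia.
have : comps (F :\ e) <= comps F; last by lia.
apply: comps_le; apply: connect_sub => a b abF.
have [E|ne] := eqVneq [set a; b] e; last by apply: connect1; rewrite /edge_rel !inE ne.
by move: E; rewrite Ee => /set2_eq[] [-> ->] //; rewrite -Ee // cn_sym.
Qed.

End Forests.

(** * Packing forests *)

Section Packing.
Variables (G : sgraph) (K : nat).
Local Notation cn F := (connect (edge_rel F)).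
Local Notation packing := {ffun 'I_K -> {set {set G}}}.
Implicit Types (f g h : packing) (e : {set G}) (i j : 'I_K) (x y u v : G).

Definition valid f :=
  [forall i, (f i \subset edges G) && all_bridges (f i)] &&
  [forall i, forall j, (i != j) ==> [disjoint f i & f j]].

Lemma validP f : reflect ((forall i, f i \subset edges G /\ all_bridges (f i)) /\
    (forall i j e, e \in f i -> e \in f j -> i = j)) (valid f).
Proof.
apply: (iffP andP) => [[/forallP v1 /forallP v2]|[v1 v2]]; split.
- by move=> i; apply/andP.
- move=> i j e ei ej; apply/eqP/negPn/negP=> ij.
  by move/forallP/(_ j)/implyP/(_ ij)/disjointFr/(_ ei): (v2 i); rewrite ej.
- by apply/forallP=> i; apply/andP.
- apply/forallP=> i; apply/forallP=> j; apply/implyP; apply: contraNT.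
  by case/pred0Pn=> e /andP[ei ej]; apply/eqP/(v2 i j e).
Qed.

Definition uncovered f e := [forall i, e \notin f i].

Definition weight f := \sum_i #|f i|.

Definition upd f i (A : {set {set G}}) : packing :=
  [ffun j => if j == i then A else f j].

Lemma valid_upd f i e (A : {set {set G}}) :
  valid f -> e \in edges G -> uncovered f e -> A \subset f i ->
  all_bridges (e |: A) -> valid (upd f i (e |: A)).
Proof.
move=> /validP[v1 v2] eG /forallP ue sA brA; apply/validP; split=> [j|j1 j2 d].
  rewrite ffunE; case: eqP => // _; split=> //.
  by rewrite subUset sub1set eG (subset_trans sA) //; case: (v1 i).
rewrite !ffunE; case: (j1 =P i) => [->|n1]; case: (j2 =P i) => [->|n2] //.
- rewrite in_setU1 => /orP[/eqP->|/(subsetP sA) dA] dj; last exact: v2 dA dj.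
  by have := ue j2; rewrite dj.
- move=> dj; rewrite in_setU1 => /orP[/eqP E|/(subsetP sA) dA]; last exact: v2 dj dA.
  by have := ue j1; rewrite -E dj.
- exact: v2.
Qed.

Lemma weight_upd f i (A : {set {set G}}) : weight (upd f i A) + #|f i| = weight f + #|A|.
Proof.
rewrite /weight (bigD1 i) //= [\sum_j #|f j|](bigD1 i) //= ffunE eqxx.
rewrite (eq_bigr (fun j => #|f j|)) => [|j /negPf ji]; last by rewrite ffunE ji.
by rewrite addnAC [#|A| + _]addnC addnAC.
Qed.

(** The elementary exchange of matroid union. It keeps the weight, so every packing reachable from a
    maximum one is again maximum. *)
Definition swap f g := valid g &&
  [exists i, exists e, exists e', [&& e \in edges G, uncovered f e, e' \in f i &
     g == upd f i (e |: (f i :\ e'))]].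

Lemma swapP f g : reflect (valid g /\ exists i e e', [/\ e \in edges G, uncovered f e,
   e' \in f i & g = upd f i (e |: (f i :\ e'))]) (swap f g).
Proof.
apply: (iffP andP) => [[vg /existsP[i /existsP[e /existsP[e' /and4P[H1 H2 H3 /eqP H4]]]]]|].
  by split=> //; exists i, e, e'.
case=> vg [i [e [e' [H1 H2 H3 H4]]]]; split=> //.
apply/existsP; exists i; apply/existsP; exists e; apply/existsP; exists e'.
by rewrite H1 H2 H3 H4 eqxx.
Qed.

Lemma weight_swap f g : swap f g -> weight g = weight f.
Proof.
case/swapP=> _ [i [e [e' [_ /forallP/(_ i) ue e'f ->]]]].
have := weight_upd f i (e |: (f i :\ e')).
rewrite cardsU1 !inE (negPf ue) andbF /=.
rewrite (cardsD1 e' (f i)) e'f; exact: addIn.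
Qed.

Lemma swap_uncovered f i e e' : valid f -> uncovered f e -> e' \in f i ->
  uncovered (upd f i (e |: (f i :\ e'))) e'.
Proof.
move=> /validP[_ v2] /forallP ue e'i; apply/forallP=> j; rewrite ffunE.
case: eqP => [_|ji]; last by apply/negP=> e'j; apply: ji; apply: v2 e'j e'i.
by rewrite !inE eqxx orbF; apply: contraTneq e'i => ->; apply: ue.
Qed.

(** * Exchanges in a maximum packing *)

Section Maximal.
Variable f : packing.
Hypotheses (vf : valid f) (maxf : forall g, valid g -> weight g <= weight f).

Let Phi g := connect swap f g.

(* Both edges exchanged by a swap lie in E0, and the ends of each are already
   connected in g i :&: E0, before and after the swap; hence the components of
   g i :&: E0 are the same for all g reachable from f. *)
Let E0 := [set e in edges G | [exists g, Phi g && uncovered g e]].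

Let Phi_valid g : Phi g -> valid g /\ weight g = weight f.
Proof.
case/connectP=> p; elim/last_ind: p g => [|p h IHp] g /=; first by move=> _ ->.
rewrite rcons_path last_rcons => /andP[pth sw] ->.
have [_ <-] := IHp _ pth erefl.
by split; [case/swapP: sw | apply: weight_swap].
Qed.

Let E0_mem g e : Phi g -> e \in edges G -> uncovered g e -> e \in E0.
Proof. by move=> Pg eG ue; rewrite inE eG; apply/existsP; exists g; rewrite Pg. Qed.

(** Each edge on the path from [x] to [y] in the forest [g i] can be exchanged for the uncovered
    edge; it is then uncovered in a reachable packing, hence belongs to [E0]. *)
Let conn_uncovered g x y i : Phi g -> adj x y -> uncovered g [set x; y] ->
  cn (g i :&: E0) x y.
Proof.
move=> Pg xy ue; have [vg wg] := Phi_valid Pg.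
have /validP[/(_ i)[sgi brgi] dg] := vg.
have eG : [set x; y] \in edges G by rewrite mem_edges.
have cxy : cn (g i) x y.
  apply/negPn/negP=> nxy.
  have vg' := valid_upd vg eG ue (subxx (g i)) (all_bridgesU1 brgi nxy).
  have := maxf vg'; have := weight_upd g i ([set x; y] |: g i).
  by rewrite cardsU1 (forallP ue i) wg; lia.
(* The path of [g i] between [x] and [y], obtained as a minimal connecting subset. *)
have [P /minsetP[/andP[sP cP] minP] _] :
    {P | minset (fun P => (P \subset g i) && cn P x y) P & P \subset g i}.
  by apply: minset_exists; rewrite subxx.
apply: (cn_mono _ cP); apply/subsetP=> e' e'P.
have e'g := subsetP sP _ e'P; rewrite inE e'g /=.
have [u [v [Ee' uv]]] := edgesP sgi e'g.
have nP : ~~ cn (P :\ e') x y.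
  apply/negP=> c; have := minP (P :\ e').
  rewrite c (subset_trans (subsetDl _ _) sP) subsetDl => /(_ isT isT) E.
  by move: e'P; rewrite -E !inE eqxx.
have sD : P :\ e' \subset g i :\ e' by apply: setSD.
(* Otherwise this connection and the two remaining pieces of [P] would join the ends of [e'] in
   [g i] without [e']. *)
have nxy : ~~ cn (g i :\ e') x y.
  apply/negP=> c; move/all_bridgesP: brgi => /(_ u v (adj_neq uv)).
  rewrite -Ee' => /(_ e'g) /negP[].
  move: cP; rewrite -(setD1K e'P) {1}Ee'.
  case/connect_setU1/or3P=> [c'|/andP[xu vy]|/andP[xv uy]]; first by rewrite c' in nP.
    rewrite cn_sym in xu; apply: connect_trans (cn_mono sD xu) _.
    by rewrite cn_sym in vy; apply: connect_trans c (cn_mono sD vy).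
  apply: connect_trans (cn_mono sD uy) _; rewrite cn_sym in c.
  exact: connect_trans c (cn_mono sD xv).
have sg : g i :\ e' \subset g i by rewrite subsetDl.
have vh := valid_upd vg eG ue sg (all_bridgesU1 (all_bridges_sub sg brgi) nxy).
apply: (E0_mem (g := upd g i ([set x; y] |: (g i :\ e')))).
- apply: connect_trans Pg (connect1 _); apply/swapP; split=> //.
  by exists i, [set x; y], e'.
- exact: (subsetP sgi).
- exact: swap_uncovered.
Qed.

Let conn_swap g h j x y : Phi g -> swap g h ->
  cn (g j :&: E0) x y = cn (h j :&: E0) x y.
Proof.
move=> Pg sw; have Ph : Phi h := connect_trans Pg (connect1 sw).
have [vg _] := Phi_valid Pg.
case/swapP: sw => vh [i [e [e' [eG ue e'g Eh]]]].
have e'h : uncovered h e' by rewrite Eh; apply: swap_uncovered.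
have [a [b [Ee ab]]] := edgesP (subxx _) eG.
have [/(_ i)[sgi _] _] := validP _ vg.
have [a' [b' [Ee' ab']]] := edgesP sgi e'g.
apply/idP/idP; apply: connect_sub => u v; rewrite /edge_rel inE => /andP[uvg uvE].
  have [E|ne] := eqVneq [set u; v] e'.
    have := conn_uncovered j Ph ab'; rewrite -Ee' => /(_ e'h).
    by move: E; rewrite Ee' => /set2_eq[] [-> ->] //; rewrite cn_sym.
  apply: connect1; rewrite /edge_rel inE uvE andbT Eh ffunE.
  by case: eqP => [E|//]; rewrite !inE ne -E uvg orbT.
have [E|ne] := eqVneq [set u; v] e.
  have := conn_uncovered j Pg ab; rewrite -Ee => /(_ ue).
  by move: E; rewrite Ee => /set2_eq[] [-> ->] //; rewrite cn_sym.
apply: connect1; rewrite /edge_rel inE uvE andbT.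
by move: uvg; rewrite Eh ffunE; case: eqP => [->|//]; rewrite !inE (negPf ne) /= => /andP[].
Qed.

Let conn_Phi g j x y : Phi g -> cn (g j :&: E0) x y = cn (f j :&: E0) x y.
Proof.
case/connectP=> p; elim/last_ind: p g => [|p h IHp] g /=; first by move=> _ ->.
rewrite rcons_path last_rcons => /andP[pth sw] ->.
rewrite -(conn_swap _ _ _ _ sw); first exact: IHp.
by apply/connectP; exists p.
Qed.

(** Every forest of [f] therefore spans each class of [E0], which fixes the size of [f j :&: E0]
    independently of [j]. *)
Let conn_E0 j x y : cn (f j :&: E0) x y = cn E0 x y.
Proof.
apply/idP/idP; first exact/cn_mono/subsetIr.
apply: connect_sub => u v; rewrite /edge_rel inE mem_edges.
case/andP=> uv /existsP[g /andP[Pg ue]].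
by rewrite -(conn_Phi _ _ _ Pg); apply: conn_uncovered.
Qed.

(** Inside [E0] every forest has its largest possible size, and a crossing edge lies outside [E0],
    hence is covered by some forest. *)
Lemma maximal_packing : exists E0 : {set {set G}},
  K * #|G| + #|[set e in edges G | [exists x, exists y, (e == [set x; y]) && ~~ cn E0 x y]]|
     <= weight f + K * comps E0.
Proof.
exists E0; set X := [set e in _ | _].
have /validP[vf1 vf2] := vf.
have cf j : #|f j :&: E0| + comps E0 = #|G|.
  have -> : comps E0 = comps (f j :&: E0).
    by apply/eqP; rewrite eqn_leq; apply/andP; split; apply: comps_le => x y; rewrite conn_E0.
  apply: card_forest; have [sf bf] := vf1 j; split.
    exact: subset_trans (subsetIl _ _) sf.
  by apply/acyclicP/(all_bridges_sub _ bf)/subsetIl.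
have sX : #|X| <= \sum_j #|f j :\: E0|.
  have : X \subset \bigcup_j (f j :\: E0).
    apply/subsetP=> e; rewrite inE => /andP[eG /existsP[x /existsP[y /andP[/eqP Ee nxy]]]].
    have eE : e \notin E0 by apply: contra nxy => eE; apply: connect1; rewrite /edge_rel -Ee.
    have : ~~ uncovered f e.
      by apply: contra eE => ue; apply: (E0_mem (g := f)); rewrite ?/Phi ?connect0.
    by case/forallPn=> j; rewrite negbK => ej; apply/bigcupP; exists j; rewrite // inE eE.
  move/subset_leq_card/leq_trans; apply.
  elim/big_rec2: _ => [|j A B _ le]; first by rewrite cards0.
  by apply: leq_trans (leq_card_setU _ _) _; rewrite leq_add2l.
have -> : weight f = \sum_j #|f j :&: E0| + \sum_j #|f j :\: E0|.
  rewrite -big_split; apply: eq_bigr => j _; exact/esym/cardsID.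
have : \sum_j #|f j :&: E0| + K * comps E0 = K * #|G|.
  have -> : K * comps E0 = \sum_(j < K) comps E0 by rewrite sum_nat_const card_ord.
  rewrite -big_split /=; under eq_bigr => j _ do rewrite cf.
  by rewrite sum_nat_const card_ord.
lia.
Qed.

End Maximal.

(* Matroid union for K copies of the graphic matroid, with the classes of E0 as
   the partition attaining equality. *)
Lemma forest_packing : exists (T : 'I_K -> {set {set G}}) (E0 : {set {set G}}),
  [/\ forall i, is_forest (T i), forall i j, i != j -> [disjoint T i & T j] &
   K * #|G| + #|[set e in edges G | [exists x, exists y, (e == [set x; y]) && ~~ cn E0 x y]]|
     <= \sum_i #|T i| + K * comps E0].
Proof.
have v0 : valid [ffun=> set0].
  apply/validP; split=> [i|i j e]; rewrite !ffunE ?inE // sub0set; split=> //.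
  by apply/all_bridgesP=> u v _; rewrite inE.
have [f vf maxf] := arg_maxnP weight v0.
have [E0 HE] := maximal_packing vf maxf.
exists f, E0; split=> // [i|i j].
  by have /validP[/(_ i)[sf bf] _] := vf; split=> //; apply/acyclicP.
by case/andP: vf => _ /forallP/(_ i)/forallP/(_ j)/implyP.
Qed.

End Packing.

(** * The largest eigenvalue *)

Local Open Scope ring_scope.

Section Eigenvalues.
Variables (R : realType) (G : sgraph).

Lemma mup_root (p : {poly R}) a : p != 0 -> (0 < mup a p)%N = root p a.
Proof. by move=> p0; rewrite mup_geq // expr1 dvdp_XsubCl. Qed.

Lemma char_poly_adj_neq0 : char_poly (adj_matrix R G) != 0.
Proof. exact/monic_neq0/char_poly_monic. Qed.

Lemma mem_eigenvalues a : (a \in eigenvalues R G) = eigenvalue (adj_matrix R G) a.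
Proof.
rewrite eigenvalue_root_char; set p := char_poly _.
have p0 : p != 0 := char_poly_adj_neq0.
have memr x : (x \in rootsR p) = root p x by have /(_ x) := roots_on_rootsR p0.
rewrite /eigenvalues mem_rev; apply/flatten_mapP/idP => [[x]|pa].
  by rewrite memr mem_nseq => px /andP[_ /eqP->].
by exists a; rewrite ?memr // mem_nseq eqxx andbT mup_root.
Qed.

Lemma lambda1_max a : a \in eigenvalues R G -> a <= lambda R 1 G.
Proof.
rewrite /lambda /eigenvalues /=; set p := char_poly _.
have p0 : p != 0 := char_poly_adj_neq0.
have memr x : (x \in rootsR p) = root p x by have /(_ x) := roots_on_rootsR p0.
have : sorted <%R (rootsR p) by apply: sorted_roots.
case/lastP: (rootsR p) memr => [|s y] // memr.
rewrite lt_sorted_pairwise pairwise_rcons => /andP[/allP ys _].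
(* A positive multiplicity puts the largest root at the head of the reversed list. *)
have : (0 < mup y p)%N by rewrite mup_root // -memr mem_rcons mem_head.
rewrite mem_rev map_rcons flatten_rcons.
case: (mup y p) => // c _; rewrite -addn1 nseqD catA cats1 rev_rcons /=.
rewrite mem_rcons inE mem_cat mem_nseq.
case/or3P=> [/eqP-> //|/flatten_mapP[x xs]|/andP[_ /eqP-> //]].
by rewrite mem_nseq => /andP[_ /eqP->]; apply/ltW/ys.
Qed.

Let vsum (v : 'rV[R]_#|G|) (x : G) :
  (v *m adj_matrix R G) 0 (enum_rank x) = \sum_(y | adj x y) v 0 (enum_rank y).
Proof.
rewrite mxE (reindex_onto enum_rank enum_val) /=; last by move=> i _; apply: enum_valK.
rewrite [RHS]big_mkcond; apply: eq_big => [y|y _]; first by rewrite enum_rankK eqxx.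
by rewrite mxE !enum_rankK adj_sym; case: adj; rewrite ?mulr1 ?mulr0.
Qed.

Lemma le_lambda1 (z : G -> R) (a : R) (x0 : G) : z x0 != 0 ->
  (forall x, \sum_(y | adj x y) z y = a * z x) -> a <= lambda R 1 G.
Proof.
move=> z0 Hz; apply: lambda1_max; rewrite mem_eigenvalues; apply/eigenvalueP.
exists (\row_i z (enum_val i)); last first.
  apply: contra_neq z0 => /rowP/(_ (enum_rank x0)); by rewrite !mxE enum_rankK.
apply/rowP=> i; rewrite -[i]enum_valK vsum !mxE !enum_rankK -Hz.
by apply: eq_bigr => y _; rewrite !mxE enum_rankK.
Qed.

(* The entrywise absolute value of an eigenvector: a subeigenvector is all that
   the upper bounds on lambda_1 need. *)
Lemma lambda1_subeigenvector : 0 < lambda R 1 G -> exists x : G -> R,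
  [/\ forall u, 0 <= x u, exists u, 0 < x u &
      forall u, lambda R 1 G * x u <= \sum_(v | adj u v) x v].
Proof.
set a := lambda R 1 G => a0.
(* Positivity excludes the default value 0 that [nth] takes on an empty list. *)
have : a \in eigenvalues R G.
  move: a0; rewrite /a /lambda /=.
  by case: (eigenvalues R G) => [|b s] /=; rewrite ?ltxx // mem_head.
rewrite mem_eigenvalues => /eigenvalueP[v va v0].
exists (fun u => `|v 0 (enum_rank u)|); split=> [//| |u].
  have [i vi] : exists i, v 0 i != 0.
    apply/existsP; apply: contraR v0 => /existsPn v0; apply/eqP/rowP=> i.
    by rewrite mxE; apply/eqP/negPn/v0.
  by exists (enum_val i); rewrite enum_valK normr_gt0.
have := vsum v u; rewrite va mxE => E.
by rewrite -[a]gtr0_norm // -normrM E ler_norm_sum.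
Qed.

End Eigenvalues.

(** * Comparison with positive supersolutions *)

Section Supersolutions.
Variables (R : realType) (G : sgraph).

Lemma adj_exchange (x z : G -> R) :
  \sum_u x u * \sum_(v | adj u v) z v = \sum_v z v * \sum_(u | adj v u) x u.
Proof.
under eq_bigr do rewrite mulr_sumr; rewrite (exchange_big_dep xpredT) //=.
apply: eq_bigr => v _; rewrite mulr_sumr; apply: eq_big => [u|u _].
  by rewrite adj_sym.
by rewrite mulrC.
Qed.

Variables (x : G -> R) (lam : R).
Hypotheses (x_ge0 : forall u, 0 <= x u) (x_neq0 : exists u, 0 < x u).
Hypothesis x_sub : forall u, lam * x u <= \sum_(v | adj u v) x v.

Lemma sum_sub_gt0 : 0 < \sum_u x u.
Proof.
have [u xu] := x_neq0; rewrite (bigD1 u) //=.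
by rewrite ltr_pwDl // sumr_ge0.
Qed.

(** Here [h] is a supergraph for which [z] is a supersolution. Both defects, of [x] against [z] and
    of [z] against [x], are nonnegative with total at most 0, so they vanish. Where [x u > 0] the
    rows of [z] over [adj] and over [h] agree, and [z > 0] leaves no room for a missing edge. *)
Lemma supersolution_eq (h : rel G) (z : G -> R) (rho : R) :
  0 < lam -> rho <= lam -> (forall u v, adj u v -> h u v) -> (forall u, 0 < z u) ->
  (forall u, \sum_(v | h u v) z v <= rho * z u) ->
  forall u, 0 < x u -> \sum_(v | h u v) z v = rho * z u /\
    (forall v, h u v -> adj u v /\ 0 < x v).
Proof.
move=> lam0 rl adjh z0 hz.
have adj_le u : \sum_(v | adj u v) z v <= \sum_(v | h u v) z v.
  rewrite [leRHS](bigID (adj u)) /=.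
  rewrite (eq_bigl (adj u)) => [|v]; last by rewrite andb_idl //; apply: adjh.
  by rewrite lerDl sumr_ge0 // => v _; apply/ltW.
have d1 u : 0 <= z u * (\sum_(v | adj u v) x v - lam * x u).
  by rewrite mulr_ge0 ?subr_ge0 // ltW.
have d2 u : 0 <= x u * (rho * z u - \sum_(v | adj u v) z v).
  by rewrite mulr_ge0 // subr_ge0 (le_trans (adj_le u)).
have S : \sum_u z u * (\sum_(v | adj u v) x v - lam * x u) +
         \sum_u x u * (rho * z u - \sum_(v | adj u v) z v) <= 0.
  have -> : \sum_u z u * (\sum_(v | adj u v) x v - lam * x u) =
     \sum_u z u * \sum_(v | adj u v) x v - \sum_u lam * (x u * z u).
    by rewrite -sumrB; apply: eq_bigr => u _; ring.
  have -> : \sum_u x u * (rho * z u - \sum_(v | adj u v) z v) =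
     \sum_u rho * (x u * z u) - \sum_u x u * \sum_(v | adj u v) z v.
    by rewrite -sumrB; apply: eq_bigr => u _; ring.
  rewrite adj_exchange -!mulr_sumr.
  have : (rho - lam) * \sum_u x u * z u <= 0.
    by rewrite mulr_le0_ge0 ?subr_le0 // sumr_ge0 // => u _; rewrite mulr_ge0 // ltW.
  rewrite mulrBl; lra.
have S1 : 0 <= \sum_u z u * (\sum_(v | adj u v) x v - lam * x u) by apply: sumr_ge0.
have S2 : 0 <= \sum_u x u * (rho * z u - \sum_(v | adj u v) z v) by apply: sumr_ge0.
have e1 u : \sum_(v | adj u v) x v = lam * x u.
  have Z : \sum_u z u * (\sum_(v | adj u v) x v - lam * x u) = 0 by lra.
  have /eqP := psumr_eq0P (fun u _ => d1 u) Z (i:=u) isT.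
  by rewrite mulf_eq0 gt_eqF //= subr_eq0 => /eqP.
have e2 u : 0 < x u -> \sum_(v | adj u v) z v = rho * z u.
  move=> xu; have Z : \sum_u x u * (rho * z u - \sum_(v | adj u v) z v) = 0 by lra.
  have /eqP := psumr_eq0P (fun u _ => d2 u) Z (i:=u) isT.
  by rewrite mulf_eq0 gt_eqF //= subr_eq0 => /eqP->.
move=> u xu; have e3 : \sum_(v | h u v) z v = rho * z u.
  by apply/eqP; rewrite eq_le hz -(e2 u xu) adj_le.
split=> // v huv.
have auv : adj u v.
  apply/negPn/negP=> nuv.
  have : \sum_(v | adj u v) z v < \sum_(v | h u v) z v; last by rewrite e2 // e3 ltxx.
  rewrite [ltRHS](bigID (adj u)) /=.
  rewrite (eq_bigl (adj u)) => [|w]; last by rewrite andb_idl //; apply: adjh.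
  rewrite ltrDl (bigD1 v) ?huv //= ltr_pwDl // sumr_ge0 // => w _; exact/ltW.
split=> //.
rewrite -(pmulr_rgt0 _ lam0) -e1 (bigD1 u) ?[adj v u]adj_sym //=.
by rewrite ltr_pwDl // sumr_ge0.
Qed.

Lemma supersolution_lt (z : G -> R) (rho : R) :
  0 < lam -> (forall u, 0 < z u) -> (forall u, \sum_(v | adj u v) z v < rho * z u) ->
  lam < rho.
Proof.
move=> lam0 z0 hz; rewrite ltNge; apply/negP=> rl.
have [u xu] := x_neq0.
have [E _] := supersolution_eq lam0 rl (fun _ _ => id) z0 (fun u => ltW (hz u)) xu.
by have := hz u; rewrite E ltxx.
Qed.

(* Hong, Shu and Fang: compare the row sums of A^2 - (d - 1) A. *)
Lemma hong_shu_fang (d : nat) : (0 < d)%N -> (forall u : G, d <= degree u)%N -> 0 <= lam ->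
  lam * (lam - d%:R + 1) <= (\sum_(u : G) degree u)%:R - d%:R * (#|G|%:R - 1).
Proof.
move=> d0 hd lam0; set D := (\sum_(u : G) degree u)%N.
have degE (u : G) : \sum_(v | adj u v) 1 = (degree u)%:R :> R.
  by rewrite sumr_const; congr (_ *+ _); rewrite /degree cardsE.
have W0 := sum_sub_gt0; set W := \sum_u x u in W0.
have row (u : G) : \sum_(v | adj u v) (degree v)%:R - (d%:R - 1) * (degree u)%:R
    <= D%:R - d%:R * (#|G|%:R - 1) :> R.
  (* The degree sum splits over the neighbours of [u], [u] itself and the other vertices, each of
     which has degree at least [d]. *)
  have H : (\sum_(v | adj u v) degree v + degree u + (#|G| - 1 - degree u) * d <= D)%N.
    rewrite /D [leqRHS](bigID (adj u)) /= -addnA leq_add2l (bigD1 u) ?adj_irrefl //= leq_add2l.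
    have -> : ((#|G| - 1 - degree u) * d = \sum_(v | ~~ adj u v && (v != u)) d)%N.
      rewrite sum_nat_const; congr (_ * _)%N.
      have := cardC (adj u); have := cardD1 u (predC (adj u)).
      rewrite !inE adj_irrefl /= /degree cardsE => E1 E2.
      have -> : #|[pred v | ~~ adj u v && (v != u)]| = #|[predD1 predC (adj u) & u]|.
        by apply: eq_card => v; rewrite !inE andbC.
      by rewrite -E2 E1 add1n addnS subn1 /= addKn.
    by apply: leq_sum.
  have dn : (degree u <= #|G| - 1)%N.
    have : (#|[set v | adj u v]| < #|[set: G]|)%N.
      apply: proper_card; rewrite properT; apply/eqP=> /setP/(_ u).
      by rewrite !inE adj_irrefl.
    by rewrite cardsT /degree; lia.
  have n0 : (0 < #|G|)%N by apply/card_gt0P; exists u.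
  move: H; rewrite -(ler_nat R) !natrD natrM natr_sum !natrB //.
  lra.
have E1 : \sum_u x u * \sum_(v | adj u v) (degree v)%:R =
          \sum_v (degree v)%:R * \sum_(u | adj v u) x u by apply: adj_exchange.
have E2 : \sum_u x u * (degree u)%:R = \sum_v \sum_(u | adj v u) x u.
  under eq_bigr do rewrite -degE.
  by rewrite adj_exchange; apply: eq_bigr => v _; rewrite mul1r.
have L1 : \sum_u x u * (\sum_(v | adj u v) (degree v)%:R - (d%:R - 1) * (degree u)%:R)
    <= W * (D%:R - d%:R * (#|G|%:R - 1)).
  by rewrite mulr_suml; apply: ler_sum => u _; rewrite ler_wpM2l.
(* [A^2 - (d - 1) A] may have negative entries, but its column sums against [x] carry the factors
   [degree v - (d - 1)], which are positive. *)
have L2 : \sum_v ((degree v)%:R - (d%:R - 1)) * (lam * x v) <=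
    \sum_u x u * (\sum_(v | adj u v) (degree v)%:R - (d%:R - 1) * (degree u)%:R).
  have -> : \sum_u x u * (\sum_(v | adj u v) (degree v)%:R - (d%:R - 1) * (degree u)%:R)
     = \sum_v ((degree v)%:R - (d%:R - 1)) * \sum_(u | adj v u) x u.
    have -> : \sum_v ((degree v)%:R - (d%:R - 1)) * (\sum_(u | adj v u) x u) =
      \sum_v ((degree v)%:R * (\sum_(u | adj v u) x u)) -
        (d%:R - 1) * \sum_v (\sum_(u | adj v u) x u).
      by rewrite mulr_sumr -sumrB; apply: eq_bigr => v _; ring.
    rewrite -E1 -E2 mulr_sumr -sumrB; apply: eq_bigr => u _; ring.
  apply: ler_sum => v _; rewrite ler_wpM2l // subr_ge0.
  have := hd v; rewrite -(ler_nat R); lra.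
have L3 : \sum_v ((degree v)%:R - (d%:R - 1)) * (lam * x v) =
   lam * (\sum_v x v * (degree v)%:R) - (d%:R - 1) * lam * W.
  by rewrite !mulr_sumr -sumrB; apply: eq_bigr => v _; ring.
have L4 : lam * W <= \sum_v x v * (degree v)%:R.
  by rewrite E2 mulr_sumr; apply: ler_sum.
rewrite -(ler_pM2l W0); apply: le_trans L1; apply: le_trans L2; rewrite L3.
have : lam * (lam * W) <= lam * (\sum_v x v * (degree v)%:R) by apply: ler_wpM2l.
lra.
Qed.

End Supersolutions.

(** * Cuts *)

Section Cuts.
Variable G : sgraph.
Implicit Types (A : {set G}) (u v w : G).

Definition cross A : rel G := fun u v => adj u v && ((u \in A) != (v \in A)).
Definition cdeg A u : nat := #|[set v | cross A u v]|.
Definition cut_size A : nat := (\sum_(u in A) cdeg A u)%N.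

Lemma cross_sym A : symmetric (cross A).
Proof. by move=> u v; rewrite /cross adj_sym eq_sym. Qed.

Lemma crossC A : cross (~: A) =2 cross A.
Proof. by move=> u v; rewrite /cross !inE; case: (u \in A); case: (v \in A). Qed.

Lemma cdegC A u : cdeg (~: A) u = cdeg A u.
Proof. by apply: eq_card => v; rewrite !inE crossC. Qed.

Lemma sum_cross1 A u : (\sum_(v | cross A u v) 1 = cdeg A u)%N.
Proof. by rewrite sum1_card /cdeg cardsE. Qed.

(** General in [M], as it serves both to count edges in [nat] and to sum real weights. *)
Lemma cross_exchange (M : nmodType) A (F : G -> M) :
  \sum_(u in A) \sum_(v | cross A u v) F v = \sum_(v in ~: A) F v *+ cdeg A v.
Proof.
rewrite (exchange_big_dep (mem (~: A))) /= => [|u v uA]; last first.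
  by rewrite /cross uA inE; case: (v \in A); rewrite ?andbF.
apply: eq_bigr => v; rewrite inE => vA.
rewrite sumr_const; congr (_ *+ _); rewrite /cdeg cardsE; apply: eq_card => u.
rewrite -[LHS]/((u \in A) && cross A u v) -[RHS]/(cross A v u) cross_sym andb_idl // /cross (negPf vA).
by case: (u \in A); rewrite ?andbF.
Qed.

Lemma cut_sizeC A : cut_size (~: A) = cut_size A.
Proof.
rewrite /cut_size [RHS](eq_bigr (fun u => \sum_(v | cross A u v) 1)%N) => [|u _]; last first.
  by rewrite sum_cross1.
have := @cross_exchange nat A (fun=> 1%N); rewrite [LHS]/= => ->.
by apply: eq_bigr => v _; rewrite cdegC natn.
Qed.

Lemma cdeg_le A u : (cdeg A u <= cut_size A)%N.
Proof.
wlog uA : A / u \in A => [H|]; last by rewrite /cut_size (bigD1 u) //= leq_addr.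
have [/H //|uA] := boolP (u \in A).
by rewrite -cdegC -cut_sizeC; apply: H; rewrite inE.
Qed.

(** With [m] crossing edges, a vertex incident to none sees at most [m] extra weight on its own
    side, which the base weight [m + 1] outweighs. A vertex incident to [c > 0] of them sees at most
    [(m + 1) * c + m] across the cut; its own surplus [b * c] pays for this because [b >= 2 * m]. *)
Lemma cdeg_row A (b : nat) u : u \in A -> (#|A| <= b)%N -> (0 < b)%N ->
  (2 * cut_size A <= b)%N ->
  (\sum_(v | adj u v) ((cut_size A).+1 + cdeg A v) < b * ((cut_size A).+1 + cdeg A u))%N.
Proof.
move=> uA Ab b0 mb; set m := cut_size A in mb *.
have H1 : (\sum_(v | adj u v && (v \in A)) (m.+1 + cdeg A v) <=
     m.+1 * (#|A| - 1) + (m - cdeg A u))%N.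
  apply: (@leq_trans (\sum_(v in A :\ u) (m.+1 + cdeg A v))).
    rewrite [leqLHS]big_mkcond [leqRHS]big_mkcond; apply: leq_sum => v _.
    rewrite !inE; case: eqP => [->|]; rewrite ?adj_irrefl //=.
    by case: (v \in A); rewrite ?andbF //; case: ifP.
  rewrite big_split /= sum_nat_const mulnC (cardsD1 u A) uA add1n subn1 leq_add2l.
  by rewrite /m /cut_size [X in (X - _)%N](big_setD1 u) //= addKn.
have H2 : (\sum_(v | adj u v && (v \notin A)) (m.+1 + cdeg A v) <=
     m.+1 * cdeg A u + (if cdeg A u == 0 then 0 else m))%N.
  have E P : (\sum_(v | adj u v && (v \notin A)) P v = \sum_(v | cross A u v) P v)%N.
    by apply: eq_bigl => v; rewrite /cross uA; case: (v \in A).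
  rewrite E big_split /= sum_nat_const mulnC.
  have -> : #|cross A u| = cdeg A u by rewrite /cdeg cardsE.
  rewrite leq_add2l; case: eqP => [/cards0_eq/setP c0|_].
    by rewrite big_pred0 // => v; have := c0 v; rewrite !inE.
  rewrite /m -cut_sizeC /cut_size [leqRHS](eq_bigr (cdeg A)) => [|v _]; last by rewrite cdegC.
  rewrite [leqLHS]big_mkcond [leqRHS]big_mkcond; apply: leq_sum => v _.
  rewrite inE /cross uA; case: (v \in A); rewrite ?andbF //=.
  by case: adj.
have A0 : (0 < #|A|)%N by apply/card_gt0P; exists u.
rewrite (bigID (mem A)) /=; apply: leq_ltn_trans (leq_add H1 H2) _.
have := cdeg_le A u; rewrite -/m.
have : (m.+1 * (#|A| - 1) <= m.+1 * (b - 1))%N by rewrite leq_mul2l leq_sub2r ?orbT.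
set c := cdeg A u; case: eqP => [->|/eqP]; first by nia.
rewrite -lt0n => c0 L1 L2.
have : (m * c <= m * c)%N by [].
have : (2 * m * c <= b * c)%N by rewrite leq_mul2r mb orbT.
have : (m <= m * c)%N by rewrite leq_pmulr.
nia.
Qed.

Lemma balanced_cut (R : realType) A (b : nat) (x : G -> R) (lam : R) :
  (forall u, 0 <= x u) -> (exists u, 0 < x u) ->
  (forall u, lam * x u <= \sum_(v | adj u v) x v) ->
  (0 < b)%N -> (#|A| <= b)%N -> (#|~: A| <= b)%N -> (2 * cut_size A <= b)%N ->
  lam < b%:R.
Proof.
move=> x0 xn0 xs b0 Ab Ab' mb.
have [lam0|lam0] := lerP lam 0; first by rewrite (le_lt_trans lam0) // ltr0n.
pose z u : R := ((cut_size A).+1 + cdeg A u)%:R.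
apply: (supersolution_lt x0 xn0 xs (z := z)) => // u.
rewrite /z -natr_sum -natrM ltr_nat.
have [uA|uA] := boolP (u \in A); first exact: cdeg_row.
have := @cdeg_row (~: A) b u; rewrite inE cut_sizeC cdegC => H.
by under eq_bigr do rewrite -cdegC; apply: H.
Qed.

End Cuts.

(** * Comparison with B_{n,s}^m *)

(* The left-hand side is the total outer weight (see sum_outer_weight) for m' <= m
   crossing edges with l distinct ends outside A; eps is its value for
   B_{n,s}^m, where m' = l = D = m. *)
Lemma star_bound (R : realFieldType) (kap N eps T m m' l D : R) :
  1 <= kap -> 1 <= l -> l <= m' -> m' <= m -> D <= m' + m' * (m' - l) ->
  2 * m ^+ 2 + 2 * m < N ->
  eps * (N * kap - m * (kap + 1)) = m ^+ 2 * (kap + 1) ->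
  T * (kap * N - m' * kap - D) = m' * kap * N ->
  T / N * (l + m' / kap) <= eps /\
  (T / N * (l + m' / kap) = eps -> m' = m /\ l = m').
Proof.
move=> k1 l1 lm' m'm hD hN heps hT.
have k0 : 0 < kap by lra.
have m1 : 1 <= m by lra.
have m'0 : 0 < m' by lra.
have mm : m <= m ^+ 2 by rewrite ler_eXnr.
have m'm' : m' ^+ 2 <= m ^+ 2 by rewrite ler_sqr ?nnegrE; lra.
have N0 : 0 < N by lra.
set Q := N * kap - m * (kap + 1) in heps.
set P := kap * N - m' * kap - D in hT.
pose j := m' - l.
have j0 : 0 <= j by rewrite /j; lra.
(* [P] with [D] replaced by its largest admissible value. *)
pose P0 := N * kap - m' * kap - m' - m' * j.
have PP0 : P0 <= P by rewrite /P0 /P /j; lra.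
have mk : m <= m * kap by rewrite ler_peMr; lra.
have m2k : m ^+ 2 <= m ^+ 2 * kap by rewrite ler_peMr ?sqr_ge0.
have hNk : (2 * m ^+ 2 + 2 * m) * kap < N * kap by rewrite ltr_pM2r.
have Qlow : 2 * m ^+ 2 * kap < Q by rewrite /Q; lra.
have m2k0 : 0 < m ^+ 2 * kap by rewrite mulr_gt0 ?exprn_gt0; lra.
have Q0 : 0 < Q by lra.
have kQ : Q <= kap * Q by rewrite ler_peMl; lra.
have t2 : 0 < kap * Q - m ^+ 2 * (kap + 1) by lra.
have jm : m' * j <= m ^+ 2.
  have : m' * j <= m' ^+ 2 by rewrite expr2 ler_wpM2l /j; lra.
  by lra.
have m'k : m' * kap <= m * kap by rewrite ler_pM2r.
have P00 : 0 < P0 by rewrite /P0; lra.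
have Pgt0 : 0 < P by lra.
(* All terms on the right are nonnegative; the second vanishes only for [m' = m], the third only for
   [l = m']. *)
have idn : m ^+ 2 * (kap + 1) * P0 - m' * (kap * l + m') * Q =
   (kap + 1) * (m ^+ 2 - m' ^+ 2) * Q + (kap + 1) * m ^+ 2 * ((m - m') * (kap + 1))
   + j * m' * (kap * Q - m ^+ 2 * (kap + 1)) by rewrite /P0 /Q /j; ring.
have kk : 0 < kap + 1 by lra.
have mgt0 : 0 < m := lt_le_trans ltr01 m1.
have mm0 : 0 <= m ^+ 2 - m' ^+ 2 by rewrite subr_ge0.
have dm : 0 <= m - m' by rewrite subr_ge0.
have dP : 0 <= P - P0 by rewrite subr_ge0.
have s1 : 0 <= (kap + 1) * (m ^+ 2 - m' ^+ 2) * Q by rewrite !mulr_ge0 // ltW.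
have s2 : 0 <= (kap + 1) * m ^+ 2 * ((m - m') * (kap + 1)).
  by apply: mulr_ge0; apply: mulr_ge0; rewrite ?sqr_ge0 // ltW.
have s3 : 0 <= j * m' * (kap * Q - m ^+ 2 * (kap + 1)) by rewrite !mulr_ge0 // ltW.
have s4 : 0 <= m ^+ 2 * (kap + 1) * (P - P0) by rewrite !mulr_ge0 ?sqr_ge0 // ltW.
have TE : T = m' * kap * N / P by rewrite -hT mulfK // gt_eqF.
have EE : eps = m ^+ 2 * (kap + 1) / Q by rewrite -heps mulfK // gt_eqF.
have lhsE : T / N * (l + m' / kap) = m' * (kap * l + m') / P.
  by rewrite TE; field; rewrite !gt_eqF.
have diff : (eps - T / N * (l + m' / kap)) * (P * Q) =
   m ^+ 2 * (kap + 1) * (P - P0) + (kap + 1) * (m ^+ 2 - m' ^+ 2) * Q +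
   (kap + 1) * m ^+ 2 * ((m - m') * (kap + 1)) + j * m' * (kap * Q - m ^+ 2 * (kap + 1)).
  rewrite lhsE EE.
  transitivity (m ^+ 2 * (kap + 1) * (P - P0) +
     (m ^+ 2 * (kap + 1) * P0 - m' * (kap * l + m') * Q)); last by rewrite idn; ring.
  by field; rewrite !gt_eqF.
have PQ : 0 < P * Q by rewrite mulr_gt0.
split; first by rewrite -subr_ge0 -(pmulr_lge0 _ PQ) diff !addr_ge0.
move=> E; rewrite E subrr mul0r in diff.
have [z2 z3] : (kap + 1) * m ^+ 2 * ((m - m') * (kap + 1)) = 0 /\
    j * m' * (kap * Q - m ^+ 2 * (kap + 1)) = 0 by split; lra.
split; apply/eqP; rewrite eq_le ?m'm ?lm' /= leNgt; apply/negP=> lt.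
  have : 0 < (kap + 1) * m ^+ 2 * ((m - m') * (kap + 1)).
    by rewrite !mulr_gt0 ?exprn_gt0 // subr_gt0.
  by rewrite z2 ltxx.
have : 0 < j * m' * (kap * Q - m ^+ 2 * (kap + 1)) by rewrite !mulr_gt0 // subr_gt0.
by rewrite z3 ltxx.
Qed.

(* The equation satisfied by r = rho + 1, for rho the spectral radius of B_{n,s}^m
   with b = n - s. *)
Lemma star_root (R : rcfType) (m s b : nat) : (s < b)%N -> (2 * m + 2 <= b)%N ->
  exists r : R, [/\ b%:R <= r, r <= b%:R + 1 &
  (r - b%:R) * (r ^+ 2 * (r - s%:R) - m%:R * (r - s%:R + 1)) =
    m%:R ^+ 2 * (r - s%:R + 1)].
Proof.
move=> sb mb.
pose p : {poly R} := ('X - b%:R%:P) * ('X^2 * ('X - s%:R%:P) - m%:R%:P * ('X - s%:R%:P + 1))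
  - (m%:R ^+ 2)%:P * ('X - s%:R%:P + 1).
have pE r : p.[r] = (r - b%:R) * (r ^+ 2 * (r - s%:R) - m%:R * (r - s%:R + 1)) -
    m%:R ^+ 2 * (r - s%:R + 1) by rewrite /p !hornerE.
have sb' : s%:R + 1 <= b%:R :> R by rewrite natr1 ler_nat.
have mb' : 2 * m%:R + 2 <= b%:R :> R by rewrite -natrM -natrD ler_nat.
have m0 : 0 <= m%:R :> R by [].
have p1 : p.[b%:R] <= 0.
  by rewrite pE subrr mul0r sub0r oppr_le0 mulr_ge0 ?sqr_ge0; lra.
have p2 : 0 <= p.[b%:R + 1].
  rewrite pE; set k := b%:R + 1 - s%:R.
  have k1 : 2 <= k by rewrite /k; lra.
  have -> : (b%:R + 1 - b%:R) * ((b%:R + 1) ^+ 2 * k - m%:R * (k + 1)) -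
    m%:R ^+ 2 * (k + 1) = k * ((b%:R + 1) ^+ 2 - 2 * m%:R - 2 * m%:R ^+ 2) +
     (k - 1) * (m%:R + m%:R ^+ 2) by ring.
  have : (2 * m%:R + 2) ^+ 2 <= (b%:R + 1) ^+ 2 :> R by rewrite ler_sqr ?nnegrE; lra.
  have -> : (2 * m%:R + 2) ^+ 2 = 4 * m%:R ^+ 2 + 8 * m%:R + 4 :> R by ring.
  have := sqr_ge0 (m%:R : R) => H1 H2.
  by rewrite addr_ge0 // mulr_ge0; lra.
have ab : b%:R <= b%:R + 1 :> R by lra.
have p12 : p.[b%:R] <= 0 <= p.[b%:R + 1] by rewrite p1 p2.
have [x /andP[x1 x2] /rootP px] := poly_ivt ab p12.
by exists x; split=> //; apply/eqP; rewrite -subr_eq0 -pE px.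
Qed.

(** * A vector modelled on the Perron vector of a star between two cliques *)

Section StarVector.
Variables (R : realType) (G : sgraph) (A : {set G}) (r T : R).
Implicit Types u v : G.

(** Both sides completed to cliques, with the crossing edges of [G] unchanged: the supergraph for
    which the vector is built. *)
Definition full : rel G :=
  fun u v => (u != v) && (((u \in A) == (v \in A)) || adj u v).

Let kap := r - #|A|%:R.
Let m' := cut_size A.
Let D := (\sum_(v in ~: A) cdeg A v ^ 2)%N.
Let l := #|[set v in ~: A | (0 < cdeg A v)%N]|.

(* On A the eigenvector equation for r - 1 is solved exactly, T being the total
   cross weight. Outside A, [0 < cdeg A v] replaces the share of T coming from
   the neighbours of v, which makes the equation exact for a star only. *)
Definition outer_weight v := T / r ^+ 2 * ((0 < cdeg A v)%N%:R + (cdeg A v)%:R / kap).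
Definition cross_weight u := \sum_(v | cross A u v) (1 + outer_weight v).
Definition star_vector u :=
  if u \in A then (cross_weight u + T / kap) / r else 1 + outer_weight u.

Hypotheses (r_gt0 : 0 < r) (kap_gt0 : 0 < kap).
(** The requirement that the cross weights sum to [T], cleared of denominators: that sum is
    [m' + T / r^2 * (m' + D / kap)]. *)
Hypothesis HT : T * (kap * r ^+ 2 - m'%:R * kap - D%:R) = m'%:R * kap * r ^+ 2.

Let sum_cdegC : \sum_(v in ~: A) (cdeg A v)%:R = m'%:R :> R.
Proof.
rewrite -natr_sum /m' -cut_sizeC; congr _%:R.
by apply: eq_bigr => v _; rewrite cdegC.
Qed.

Lemma sum_outer_weight :
  \sum_(v in ~: A) outer_weight v = T / r ^+ 2 * (l%:R + m'%:R / kap).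
Proof.
rewrite -mulr_sumr big_split /= -mulr_suml sum_cdegC; congr (_ * (_ + _)).
rewrite -natr_sum /l -sum1_card big_mkcond [X in _ = X%:R]big_mkcond; congr _%:R.
by apply: eq_bigr => v _; rewrite !inE; case: (v \in A).
Qed.

Lemma sum_cross_weight : \sum_(u in A) cross_weight u = T.
Proof.
rewrite cross_exchange.
have -> : \sum_(v in ~: A) (1 + outer_weight v) *+ cdeg A v =
  m'%:R + T / r ^+ 2 * (m'%:R + D%:R / kap).
  rewrite -sum_cdegC /D natr_sum.
  rewrite mulr_suml -big_split mulr_sumr -big_split /=; apply: eq_bigr => v _.
  rewrite -mulr_natr /outer_weight natrX; case: (cdeg A v) => [|c] /=; first by ring.
  by ring.
have -> : T / r ^+ 2 * (m'%:R + D%:R / kap) = T - m'%:R.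
  have -> : T / r ^+ 2 * (m'%:R + D%:R / kap) =
     T - T * (kap * r ^+ 2 - m'%:R * kap - D%:R) / (kap * r ^+ 2).
    by field; rewrite !gt_eqF.
  by rewrite HT; field; rewrite !gt_eqF.
by ring.
Qed.

Lemma full_row (z : G -> R) u : \sum_(v | full u v) z v =
  \sum_(v | (v \in A) == (u \in A)) z v - z u + \sum_(v | cross A u v) z v.
Proof.
rewrite (bigID (fun v => (v \in A) == (u \in A))) /=; congr (_ + _); last first.
  apply: eq_bigl => v; rewrite /full /cross.
  have [->|_] := eqVneq u v; first by rewrite adj_irrefl.
  by case: (u \in A); case: (v \in A); rewrite ?andbF ?andbT.
rewrite [in RHS](bigD1 u) //= addrAC subrr add0r.
apply: eq_bigl => v; rewrite /full eq_sym.
by case: (u \in A); case: (v \in A); rewrite ?andbF ?andbT.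
Qed.

Lemma star_vector_row_in u : u \in A ->
  \sum_(v | full u v) star_vector v = (r - 1) * star_vector u.
Proof.
move=> uA; rewrite full_row.
(* The total weight of [A] is [(T + #|A| * T / kap) / r], and [kap + #|A| = r]. *)
have -> : \sum_(v | (v \in A) == (u \in A)) star_vector v = T / kap.
  rewrite uA; under eq_bigl do rewrite eqb_id.
  rewrite (eq_bigr (fun v => (cross_weight v + T / kap) / r)) => [|v vA]; last first.
    by rewrite /star_vector vA.
  rewrite -mulr_suml big_split /= sum_cross_weight sumr_const -mulr_natr.
  have -> : #|A|%:R = r - kap by rewrite /kap; ring.
  by field; rewrite !gt_eqF.
have -> : \sum_(v | cross A u v) star_vector v = cross_weight u.
  apply: eq_bigr => v; rewrite /cross uA /star_vector => /andP[_].
  by case: (v \in A).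
by rewrite /star_vector uA; field; rewrite !gt_eqF.
Qed.

(** The defect has a global part, controlled by the choice of [r], and a local part, zero when the
    neighbours of [v] in [A] carry all of [T] or when there are none. *)
Lemma star_vector_row_out v : v \notin A ->
  \sum_(w | full v w) star_vector w = (r - 1) * star_vector v
    + (#|~: A|%:R + \sum_(w in ~: A) outer_weight w - r)
    + (\sum_(u | cross A v u) cross_weight u - T * (0 < cdeg A v)%N%:R) / r.
Proof.
move=> vA; rewrite full_row.
have -> : \sum_(w | (w \in A) == (v \in A)) star_vector w =
   #|~: A|%:R + \sum_(w in ~: A) outer_weight w.
  rewrite -sumr_const -big_split /= (negPf vA).
  rewrite (eq_bigl (fun w => w \in ~: A)) => [|w]; last by rewrite inE; case: (w \in A).
  by apply: eq_bigr => w; rewrite inE /star_vector => /negPf->.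
have -> : \sum_(u | cross A v u) star_vector u =
   (\sum_(u | cross A v u) cross_weight u + T / kap * (cdeg A v)%:R) / r.
  rewrite (eq_bigr (fun u => (cross_weight u + T / kap) / r)) => [|u]; last first.
    by rewrite /cross (negPf vA) /star_vector => /andP[_]; case: (u \in A).
  rewrite -mulr_suml big_split /= sumr_const -[_ *+ #|_|]mulr_natr.
  by rewrite /cdeg cardsE.
rewrite /star_vector (negPf vA) /outer_weight.
by field; rewrite !gt_eqF.
Qed.

End StarVector.

(** * Cuts whose edges form a star *)

Section Stars.
Variables (G : sgraph) (A : {set G}).
Implicit Types u v : G.

Definition star_at u0 := forall u v, u \in A -> v \notin A -> adj u v -> u = u0.

Let m' := cut_size A.
Let D := (\sum_(v in ~: A) cdeg A v ^ 2)%N.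
Let l := #|[set v in ~: A | (0 < cdeg A v)%N]|.

Let sum_cdegC : (\sum_(v in ~: A) cdeg A v)%N = m'.
Proof. by rewrite /m' -cut_sizeC; apply: eq_bigr => v _; rewrite cdegC. Qed.

Let sum_pos_cdeg : (\sum_(v in ~: A) (0 < cdeg A v))%N = l.
Proof.
rewrite /l -sum1_card big_mkcond [RHS]big_mkcond; apply: eq_bigr => v _.
by rewrite !inE; case: (v \in A) => //=; case: ltnP.
Qed.

(** Termwise this is [(c - 1) * (c - m') <= 0] for [1 <= c <= m']; it provides the bound on [D] in
    [star_bound]. *)
Lemma sum_sqr_cdeg : (D + m' * l <= m' + m' * m')%N.
Proof.
have -> : (D + m' * l = \sum_(v in ~: A) (cdeg A v ^ 2 + m' * (0 < cdeg A v)))%N.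
  by rewrite big_split -big_distrr /= sum_pos_cdeg.
have -> : (m' + m' * m' = \sum_(v in ~: A) (cdeg A v + m' * cdeg A v))%N.
  by rewrite big_split -big_distrr /= sum_cdegC.
apply: leq_sum => v _; have := cdeg_le A v; rewrite -/m'.
by case: (cdeg A v) => [|c] cm /=; rewrite ?muln0 // ; nia.
Qed.

Lemma pos_cdeg_le : (l <= m')%N.
Proof.
by rewrite -sum_pos_cdeg -sum_cdegC; apply: leq_sum => v _; case: (cdeg A v).
Qed.

Lemma pos_cdeg_gt0 : (0 < m')%N -> (0 < l)%N.
Proof.
rewrite !lt0n -sum_cdegC -sum_pos_cdeg; apply: contra.
rewrite !sum_nat_eq0 => /forallP H; apply/forallP=> v; apply/implyP=> vA.
by have := H v; rewrite vA /=; case: (cdeg A v).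
Qed.

Section StarAt.
Variable u0 : G.
Hypothesis stu0 : star_at u0.

Lemma star_cdeg v : v \in ~: A -> cdeg A v = (0 < cdeg A v)%N.
Proof.
rewrite inE => vA; have : (cdeg A v <= #|[set u0]|)%N.
  apply/subset_leq_card/subsetP=> u; rewrite !inE /cross (negPf vA) adj_sym.
  by case uA: (u \in A); rewrite ?andbF // => /andP[uv _]; apply/eqP/(stu0 uA vA uv).
by rewrite cards1; case: (cdeg A v) => [|[]].
Qed.

Lemma star_l : l = m'.
Proof. by rewrite -sum_pos_cdeg -sum_cdegC; apply: eq_bigr => v /star_cdeg. Qed.

Lemma star_D : D = m'.
Proof.
by rewrite /D -sum_cdegC; apply: eq_bigr => v /star_cdeg->; case: (0 < _)%N.
Qed.

Lemma star_cut_size : u0 \in A -> cdeg A u0 = m'.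
Proof.
move=> u0A; rewrite /m' /cut_size (bigD1 u0) //= big1 ?addn0 // => u /andP[uA ne].
apply/eqP; rewrite cards_eq0; apply/eqP/setP=> v; rewrite !inE /cross uA.
case vA: (v \in A); rewrite ?andbF // andbT; apply: contraNF ne => uv.
by apply/eqP/(stu0 uA _ uv); rewrite vA.
Qed.

(** For a star between cliques both defects of [star_vector] vanish, so it is an eigenvector for
    [r - 1]. *)
Lemma le_lambda1_star (R : realType) (r : R) (m : nat) : u0 \in A ->
  (forall u v, u != v -> (u \in A) = (v \in A) -> adj u v) ->
  (#|A| < #|~: A|)%N -> (2 * m + 2 <= #|~: A|)%N -> cut_size A = m ->
  #|~: A|%:R <= r ->
  (r - #|~: A|%:R) * (r ^+ 2 * (r - #|A|%:R) - m%:R * (r - #|A|%:R + 1)) =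
    m%:R ^+ 2 * (r - #|A|%:R + 1) ->
  r - 1 <= lambda R 1 G.
Proof.
move=> u0A cl sb mb m'm br; set kap := r - #|A|%:R => hr.
have s0 : 0 <= #|A|%:R :> R by [].
have sb' : #|A|%:R + 1 <= #|~: A|%:R :> R by rewrite natr1 ler_nat.
have mb' : 2 * m%:R + 2 <= #|~: A|%:R :> R by rewrite -natrM -natrD ler_nat.
have m0 : 0 <= m%:R :> R by [].
have r0 : 0 < r by lra.
have k1 : 1 <= kap by rewrite /kap; lra.
have k0 : 0 < kap by lra.
have r2 : 2 * m%:R < r ^+ 2.
  have : r * 1 <= r * r by rewrite ler_pM2l //; lra.
  rewrite mulr1 -expr2; lra.
have P0 : 0 < kap * r ^+ 2 - m%:R * kap - m%:R.
  have : 2 * m%:R * kap < r ^+ 2 * kap by rewrite ltr_pM2r.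
  have : m%:R * 1 <= m%:R * kap by rewrite ler_wpM2l.
  lra.
pose T := m%:R * kap * r ^+ 2 / (kap * r ^+ 2 - m%:R * kap - m%:R).
have T0 : 0 <= T by rewrite /T !mulr_ge0 ?sqr_ge0 ?invr_ge0 //; lra.
have HT : T * (kap * r ^+ 2 - (cut_size A)%:R * kap - D%:R) = (cut_size A)%:R * kap * r ^+ 2.
  by rewrite star_D -/m' /m' m'm /T divfK // gt_eqF.
(* The equation for [r] says exactly that the global defect is zero. *)
have Hsum : \sum_(w in ~: A) outer_weight A r T w = r - #|~: A|%:R.
  rewrite sum_outer_weight -/l star_l /m' m'm -/kap.
  have Q0 : 0 < r ^+ 2 * kap - m%:R * (kap + 1) by lra.
  have -> : r - #|~: A|%:R = m%:R ^+ 2 * (kap + 1) / (r ^+ 2 * kap - m%:R * (kap + 1)).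
    by rewrite -hr mulfK // gt_eqF.
  by rewrite /T; field; rewrite !gt_eqF //; lra.
have cw u : u \in A -> u != u0 -> cross_weight A r T u = 0.
  move=> uA ne; rewrite /cross_weight big_pred0 // => v.
  rewrite /cross uA; case vA: (v \in A); rewrite ?andbF // andbT.
  by apply: contraNF ne => uv; apply/eqP/(stu0 uA _ uv); rewrite vA.
have cw0 : cross_weight A r T u0 = T.
  have := sum_cross_weight r0 k0 HT; rewrite (bigD1 u0) //= big1 ?addr0 // => u /andP[].
  exact: cw.
have fullE u v : adj u v = full A u v.
  rewrite /full; have [->|ne] := eqVneq u v; first by rewrite adj_irrefl.
  by have [E|//] := eqVneq (u \in A) (v \in A); rewrite cl.
have [v0 v0A] : exists v, v \in ~: A by apply/card_gt0P/(leq_ltn_trans _ sb).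
apply: (le_lambda1 (z := star_vector A r T) (x0 := v0)).
  move: v0A; rewrite inE /star_vector => /negPf->; rewrite gt_eqF // ltr_pwDl //.
  apply: mulr_ge0; first by rewrite divr_ge0 ?sqr_ge0.
  by apply: addr_ge0; rewrite ?divr_ge0 ?ler0n ?ltW.
move=> v; rewrite (eq_bigl (full A v)) => [|w]; last exact: fullE.
have [vA|vA] := boolP (v \in A); first exact: star_vector_row_in.
rewrite star_vector_row_out // Hsum.
have -> : \sum_(u | cross A v u) cross_weight A r T u = T * (0 < cdeg A v)%N%:R.
  have crE u : cross A v u -> u = u0.
    rewrite /cross (negPf vA) adj_sym; case uA: (u \in A); rewrite ?andbF // => /andP[uv _].
    exact: stu0 uv.
  rewrite (eq_bigr (fun=> T)) => [|u /crE->//]; rewrite sumr_const -[LHS]mulr_natr; congr (_ * _).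
  by rewrite -[in RHS]star_cdeg ?inE // /cdeg cardsE.
by rewrite subrr mul0r; ring.
Qed.

Lemma star_isomorphic : u0 \in A ->
  (forall u v, u != v -> (u \in A) = (v \in A) -> adj u v) ->
  isomorphic G (B_graph #|G| #|A| (cut_size A)).
Proof.
move=> u0A cl; pose W := [set v in ~: A | adj u0 v].
have cW : #|W| = cut_size A.
  rewrite -/m' -star_cut_size //; apply: eq_card => v; rewrite !inE /cross u0A.
  by case: (v \in A); rewrite ?andbF ?andbT.
(* The order matches the numbering of [B_graph]: centre, rest of its clique, the neighbours across,
   all others. Hence [index] is the isomorphism. *)
pose L := (u0 :: enum (A :\ u0)) ++ enum W ++ enum (~: (A :|: W)).
have memL x : x \in L by rewrite !(mem_cat, inE, mem_enum); case: eqP; case: (x \in A); case: adj.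
have sA : size (u0 :: enum (A :\ u0)) = #|A| by rewrite /= -cardE (cardsD1 u0 A) u0A.
have sL : size L = #|G|.
  rewrite !size_cat sA -!cardE -(cardsC (A :|: W)) addnA; congr (_ + _)%N.
  rewrite cardsU; have -> : A :&: W = set0; last by rewrite cards0 subn0.
  by apply/setP=> v; rewrite !inE; case: (v \in A).
have mA x : (x \in u0 :: enum (A :\ u0)) = (x \in A).
  by rewrite inE mem_enum !inE; case: eqP => [->|].
have iA x : (index x L < #|A|)%N = (x \in A).
  rewrite index_cat mA; case: ifP => xA; first by rewrite -sA index_mem mA.
  by rewrite sA ltnNge leq_addr.
have i0 x : (index x L == 0%N) = (x == u0).
  by rewrite /L /= [x == u0]eq_sym; case: (u0 == x).
have iW x : (#|A| <= index x L < #|A| + cut_size A)%N = (x \in W).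
  rewrite leqNgt iA -cW; have [xA|xA] := boolP (x \in A); first by rewrite !inE xA.
  rewrite index_cat mA (negPf xA) sA ltn_add2l index_cat mem_enum.
  case: ifP => xW; first by rewrite cardE index_mem mem_enum xW.
  by rewrite -cardE ltnNge leq_addr.
have iL x : (index x L < #|G|)%N by rewrite -sL index_mem.
have injL x y : index x L = index y L -> x = y.
  by move=> E; rewrite -(nth_index u0 (memL x)) E nth_index.
exists (fun x => Ordinal (iL x)); split.
  apply: inj_card_bij; last by rewrite card_ord.
  by move=> x y [] /injL.
move=> x y; rewrite /= /B_adj -val_eqE /= !iA !i0 !iW.
have -> : (index x L == index y L) = (x == y).
  by apply/eqP/eqP=> [/injL|->].
have [->|ne] := eqVneq x y; first by rewrite adj_irrefl.
rewrite !inE /=; case xA: (x \in A); case yA: (y \in A) => /=.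
- by rewrite cl // xA yA.
- rewrite andbF orbF; apply/andP/idP=> [[/eqP->]//|xy].
  by rewrite -(stu0 xA (negbT yA) xy).
- rewrite andbF /=; apply/andP/idP=> [[/eqP->]|]; rewrite adj_sym // => xy.
  by rewrite -(stu0 yA (negbT xA) xy).
- by rewrite cl // xA yA.
Qed.

End StarAt.
End Stars.

Lemma card_ord_lt (n a : nat) : (a <= n)%N -> #|[set i : 'I_n | (i < a)%N]| = a.
Proof.
move=> an; have inj : injective (widen_ord an) by move=> i j /(congr1 val)/= /val_inj.
rewrite -[RHS]card_ord -cardsT -(card_imset _ inj).
apply: eq_card => i; rewrite inE; apply/idP/imsetP => [ia|[j _ ->]]; last exact: (valP j).
by exists (Ordinal ia) => //; apply: val_inj.
Qed.

Lemma B_lambda1 (R : realType) (n s m : nat) (r : R) :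
  (0 < s)%N -> (2 * s < n)%N -> (2 * m + 2 <= n - s)%N -> (n - s)%:R <= r ->
  (r - (n - s)%:R) * (r ^+ 2 * (r - s%:R) - m%:R * (r - s%:R + 1)) =
    m%:R ^+ 2 * (r - s%:R + 1) ->
  r - 1 <= lambda R 1 (B_graph n s m).
Proof.
move=> s0 sn mn; pose A := [set i : B_graph n s m | (i < s)%N].
have cA : #|A| = s by rewrite card_ord_lt //; lia.
have cAC : #|~: A| = (n - s)%N by rewrite -cA -(addKn #|A| #|~: A|) cardsC card_ord.
have n0 : (0 < n)%N by lia.
pose u0 : B_graph n s m := Ordinal n0.
have u0A : u0 \in A by rewrite inE.
have st : star_at A u0.
  move=> u v; rewrite !inE -leqNgt /= /B_adj => us sv /andP[_]; apply: contraTeq => ne.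
  rewrite us ltnNge sv /= negb_or; apply/andP; split.
    by rewrite (_ : (u == 0 :> nat) = (u == u0)) // (negPf ne).
  by rewrite [(s <= u)%N]leqNgt us andbF.
have cl u v : u != v -> (u \in A) = (v \in A) -> adj u v.
  by rewrite !inE /= /B_adj => -> ->; rewrite eqxx.
have cm : cut_size A = m.
  rewrite -(star_cut_size st u0A) /cdeg.
  have -> : [set v | cross A u0 v] = [set i : 'I_n | (i < s + m)%N] :\: [set i : 'I_n | (i < s)%N].
    apply/setP=> v; rewrite !inE /cross !inE /= /B_adj s0 -leqNgt.
    case: (leqP s v) => sv /=; last by rewrite andbF.
    rewrite andbT -val_eqE /= (_ : (0 == v)%N = false) /=; last by lia.
    by rewrite (_ : (v == 0 :> nat) = false) ?orbF //; lia.
  rewrite cardsD (setIidPr _); last by apply/subsetP=> i; rewrite !inE; lia.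
  by rewrite !card_ord_lt; lia.
move=> br hr; apply: (le_lambda1_star st u0A cl _ _ cm); rewrite ?cAC ?cA //; lia.
Qed.

(** If there are crossing edges, [star_bound] makes [star_vector] a supersolution for [r - 1], so
    [r - 1 <= lam] forces equality everywhere: [supersolution_eq] then yields the two cliques, and
    the vanishing defects yield the star. *)
Lemma star_extremal (R : realType) (G : sgraph) (A : {set G}) (m : nat) (r lam : R)
    (x : G -> R) :
  (forall u, 0 <= x u) -> (exists u, 0 < x u) ->
  (forall u, lam * x u <= \sum_(v | adj u v) x v) ->
  (0 < #|A|)%N -> (#|A| < #|~: A|)%N -> (2 * m + 2 <= #|~: A|)%N ->
  (forall u : G, #|A| <= (degree u).+1)%N -> (cut_size A <= m)%N ->
  #|~: A|%:R <= r ->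
  (r - #|~: A|%:R) * (r ^+ 2 * (r - #|A|%:R) - m%:R * (r - #|A|%:R + 1)) =
    m%:R ^+ 2 * (r - #|A|%:R + 1) ->
  r - 1 <= lam ->
  exists u0, [/\ u0 \in A, star_at A u0, cut_size A = m &
    forall u v, u != v -> (u \in A) = (v \in A) -> adj u v].
Proof.
move=> x0 xn0 xs s0 sb mb dA m'm br; set kap := r - #|A|%:R => hr rl.
have sR : 1 <= #|A|%:R :> R by rewrite ler1n.
have sb' : #|A|%:R + 1 <= #|~: A|%:R :> R by rewrite natr1 ler_nat.
have mb' : 2 * m%:R + 2 <= #|~: A|%:R :> R by rewrite -natrM -natrD ler_nat.
have m0 : 0 <= m%:R :> R by [].
have r0 : 0 < r by lra.
have k1 : 1 <= kap by rewrite /kap; lra.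
have k0 : 0 < kap by lra.
have lam0 : 0 < lam by lra.
have [u1 u1A] : exists u, u \in A by apply/card_gt0P.
have adj_full u v : adj u v -> full A u v.
  by move=> uv; rewrite /full uv orbT andbT adj_neq.
(* Without crossing edges [T] would be 0 and [star_vector] would vanish on [A]; the constant vector
   replaces it. *)
have [c0|c0] := posnP (cut_size A).
  have nocross u v : cross A u v = false.
    apply/negP=> uv; have := cdeg_le A u; rewrite c0 leqn0 cards_eq0.
    by move/eqP/setP/(_ v); rewrite !inE uv.
  have rowE u : \sum_(v | full A u v) 1 = (if u \in A then #|A|%:R else #|~: A|%:R) - 1 :> R.
    rewrite full_row [X in _ + X]big1 => [|v]; last by rewrite nocross.
    rewrite addr0; congr (_ - _); case: ifP => uA; rewrite -sumr_const; apply: eq_bigl => v.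
      by rewrite eqb_id.
    by rewrite inE; case: (v \in A).
  have row u : \sum_(v | full A u v) 1 <= (r - 1) * 1 :> R by rewrite rowE; case: ifP => _; lra.
  have eqs := supersolution_eq x0 xs lam0 rl adj_full (z := fun=> 1) (fun=> ltr01) row.
  have xA u : 0 < x u -> u \notin A.
    move=> xu; have [E _] := eqs u xu; apply/negP=> uA; move: E; rewrite rowE uA; lra.
  have [u xu] := xn0; have uA := xA u xu.
  have [E _] := eqs u xu; rewrite rowE (negPf uA) in E.
  have rb : r = #|~: A|%:R by lra.
  (* At [r = #|~: A|] the left side of the equation for [r] is zero. *)
  have m00 : m = 0%N.
    apply/eqP; rewrite -(eqr_nat R); move/esym/eqP: hr; rewrite rb subrr mul0r mulf_eq0.
    by rewrite sqrf_eq0 => /orP[//|/eqP]; lra.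
  have xout v : v \notin A -> 0 < x v.
    move=> vA; have [->//|ne] := eqVneq v u.
    have [_ /(_ v) []//] := eqs u xu.
    by rewrite /full eq_sym ne (negPf uA) (negPf vA).
  exists u1; split=> //; last 2 first.
  - by rewrite c0 m00.
  - move=> u2 v2 ne E2; have [u2A|u2A] := boolP (u2 \in A); last first.
      have [_ /(_ v2) []//] := eqs u2 (xout _ u2A).
      by rewrite /full ne E2 eqxx.
    (* As [x] vanishes on [A], completeness of [A] comes from the degree hypothesis. *)
    have : [set v | adj u2 v] = A :\ u2.
      apply/eqP; rewrite eqEcard; apply/andP; split.
        apply/subsetP=> v; rewrite !inE => uv; rewrite eq_sym adj_neq //=.
        by have := nocross u2 v; rewrite /cross uv u2A; case: (v \in A).
      by have := dA u2; rewrite (cardsD1 u2 A) u2A add1n ltnS.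
    by move/setP/(_ v2); rewrite !inE eq_sym ne -E2 u2A => ->.
  move=> u2 v2 u2A v2A uv; have := nocross u2 v2.
  by rewrite /cross uv u2A (negPf v2A).
have l0 := pos_cdeg_gt0 c0; have lm' := pos_cdeg_le A; have Dle := sum_sqr_cdeg A.
set l := #|_| in l0 lm' Dle; set D := (\sum_(v in ~: A) cdeg A v ^ 2)%N in Dle.
set m' := cut_size A in m'm c0 lm' Dle *.
have l1R : 1 <= l%:R :> R by rewrite ler1n.
have lm'R : l%:R <= m'%:R :> R by rewrite ler_nat.
have m'mR : m'%:R <= m%:R :> R by rewrite ler_nat.
have DleR : D%:R <= m'%:R + m'%:R * (m'%:R - l%:R) :> R.
  by move: Dle; rewrite -(ler_nat R) !natrD !natrM; lra.
have r2 : 2 * m%:R ^+ 2 + 2 * m%:R < r ^+ 2.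
  have : (2 * m%:R + 2) ^+ 2 <= r ^+ 2 by rewrite ler_sqr ?nnegrE; lra.
  have -> : (2 * m%:R + 2) ^+ 2 = 4 * m%:R ^+ 2 + 8 * m%:R + 4 :> R by ring.
  by have := sqr_ge0 (m%:R : R); lra.
have P0 : 0 < kap * r ^+ 2 - m'%:R * kap - D%:R.
  have h1 : m'%:R * (m'%:R - l%:R) <= m%:R * m%:R :> R by apply: ler_pM; lra.
  have h2 : m'%:R * kap <= m%:R * kap by rewrite ler_pM2r.
  have h3 : (2 * m%:R ^+ 2 + 2 * m%:R) * kap < r ^+ 2 * kap by rewrite ltr_pM2r.
  have h4 : m%:R ^+ 2 * 1 <= m%:R ^+ 2 * kap by rewrite ler_wpM2l ?sqr_ge0.
  have h5 : m%:R * 1 <= m%:R * kap by rewrite ler_wpM2l.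
  by have := sqr_ge0 (m%:R : R); lra.
pose T := m'%:R * kap * r ^+ 2 / (kap * r ^+ 2 - m'%:R * kap - D%:R).
have T0 : 0 < T by rewrite /T !mulr_gt0 ?exprn_gt0 ?invr_gt0 ?ltr0n.
have HT : T * (kap * r ^+ 2 - m'%:R * kap - D%:R) = m'%:R * kap * r ^+ 2.
  by rewrite /T divfK // gt_eqF.
have hr' : (r - #|~: A|%:R) * (r ^+ 2 * kap - m%:R * (kap + 1)) = m%:R ^+ 2 * (kap + 1) by [].
have [bound bound_eq] := star_bound k1 l1R lm'R m'mR DleR r2 hr' HT.
have SW := sum_outer_weight A r T; rewrite -/l -/m' -/kap in SW.
have ow0 v : 0 <= outer_weight A r T v.
  apply: mulr_ge0; first by rewrite divr_ge0 ?sqr_ge0 ?ltW.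
  by apply: addr_ge0; rewrite ?divr_ge0 ?ler0n ?ltW.
have cw0 u : 0 <= cross_weight A r T u.
  by apply: sumr_ge0 => v _; rewrite addr_ge0.
have cwT : \sum_(u in A) cross_weight A r T u = T := sum_cross_weight r0 k0 HT.
have z0 u : 0 < star_vector A r T u.
  rewrite /star_vector; case: ifP => _; last by rewrite ltr_pwDl.
  by rewrite divr_gt0 // ltr_wpDl // divr_gt0.
have subA v : v \notin A -> \sum_(u | cross A v u) cross_weight A r T u +
    \sum_(u in A | ~~ cross A v u) cross_weight A r T u = T.
  move=> vA; apply/esym/(etrans (esym cwT)).
  rewrite [LHS](bigID (cross A v)) /=; congr (_ + _).
  apply: eq_bigl => u; rewrite andb_idl //.
  by rewrite /cross (negPf vA); case: (u \in A); rewrite ?andbF.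
have crossT v : v \notin A ->
    \sum_(u | cross A v u) cross_weight A r T u <= T * (0 < cdeg A v)%N%:R.
  move=> vA; have [E|_] := posnP (cdeg A v).
    rewrite big_pred0 ?mulr0 // => u; move/eqP: E; rewrite cards_eq0 => /eqP/setP/(_ u).
    by rewrite !inE.
  by rewrite mulr1 -{2}(subA v vA) lerDl sumr_ge0.
have row u : \sum_(v | full A u v) star_vector A r T v <= (r - 1) * star_vector A r T u.
  have [uA|uA] := boolP (u \in A); first by rewrite star_vector_row_in.
  rewrite star_vector_row_out // -addrA gerDl SW.
  have : (\sum_(w | cross A u w) cross_weight A r T w - T * (0 < cdeg A u)%N%:R) / r <= 0.
    by rewrite mulr_le0_ge0 ?subr_le0 ?crossT ?invr_ge0 ?ltW.
  lra.
have eqs := supersolution_eq x0 xs lam0 rl adj_full z0 row.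
have side u : 0 < x u -> forall v, (u \in A) = (v \in A) -> 0 < x v.
  move=> xu v E; have [<-//|ne] := eqVneq u v.
  have [_ /(_ v) []//] := eqs u xu; by rewrite /full ne E eqxx.
have [u2 [v2 [u2A v2A uv2]]] : exists u v, [/\ u \in A, v \notin A & adj u v].
  move: c0; rewrite /m' /cut_size lt0n sum_nat_eq0 negb_forall => /existsP[u].
  rewrite negb_imply cards_eq0 => /andP[uA /set0Pn[v]].
  rewrite inE /cross uA => /andP[uv]; rewrite eq_sym eqb_id => vA.
  by exists u, v.
have xp u : 0 < x u.
  have xA : 0 < x u2.
    have [u3 xu3] := xn0; have [u3A|u3A] := boolP (u3 \in A).
      by apply: side xu3 _ _; rewrite u3A u2A.
    have xv2 : 0 < x v2 by apply: side xu3 _ _; rewrite (negPf u3A) (negPf v2A).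
    by have [_ /(_ u2) []//] := eqs v2 xv2; rewrite adj_full // adj_sym.
  have xv2 : 0 < x v2 by have [_ /(_ v2) []//] := eqs u2 xA; rewrite adj_full.
  have [uA|uA] := boolP (u \in A); first by apply: side xA _ _; rewrite uA u2A.
  by apply: side xv2 _ _; rewrite (negPf uA) (negPf v2A).
have cl u v : u != v -> (u \in A) = (v \in A) -> adj u v.
  move=> ne E; have [_ /(_ v) []//] := eqs u (xp u); by rewrite /full ne E eqxx.
(* Both defects are nonpositive and their sum is zero, so each of them is zero. *)
have eqv v : v \notin A -> \sum_(w in ~: A) outer_weight A r T w = r - #|~: A|%:R /\
    \sum_(u | cross A v u) cross_weight A r T u = T * (0 < cdeg A v)%N%:R.
  move=> vA; have [+ _] := eqs v (xp v); rewrite star_vector_row_out // -addrA => E.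
  have {E} : #|~: A|%:R + \sum_(w in ~: A) outer_weight A r T w - r +
    (\sum_(u | cross A v u) cross_weight A r T u - T * (0 < cdeg A v)%N%:R) / r = 0 by lra.
  set S := (_ - T * _).
  have S0 : S <= 0 by rewrite subr_le0 crossT.
  have : S / r <= 0 by apply: mulr_le0_ge0; rewrite // invr_ge0 ltW.
  rewrite SW => S1 E; have /eqP : S / r = 0 by lra.
  rewrite mulf_eq0 invr_eq0 (gt_eqF r0) orbF subr_eq0 => /eqP SE.
  by split; [lra | rewrite SE].
have [SWE cE] := eqv v2 v2A.
have [m'E lE] : m'%:R = m%:R :> R /\ l%:R = m'%:R :> R by apply: bound_eq; rewrite -SW SWE.
have cw_pos u v : cross A u v -> 0 < cross_weight A r T u.
  move=> uv; rewrite /cross_weight (bigD1 v) //= ltr_pwDl ?ltr_pwDl //.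
  by apply: sumr_ge0 => w _; rewrite addr_ge0.
have d2 : (0 < cdeg A v2)%N.
  by apply/card_gt0P; exists u2; rewrite inE /cross adj_sym uv2 u2A (negPf v2A).
(* As many ends outside [A] as crossing edges: no vertex outside meets two of them. *)
have d1 : (cdeg A v2 <= 1)%N.
  move/eqP: lE; rewrite eqr_nat => /eqP lE.
  have E1 : (\sum_(v in ~: A) cdeg A v = m')%N.
    by rewrite /m' -cut_sizeC; apply: eq_bigr => v _; rewrite cdegC.
  have E2 : (\sum_(v in ~: A) (0 < cdeg A v) = l)%N.
    rewrite /l -sum1_card big_mkcond [RHS]big_mkcond; apply: eq_bigr => v _.
    by rewrite !inE; case: (v \in A) => //=; case: ltnP.
  rewrite leqNgt; apply/negP=> d12.
  have : (\sum_(v in ~: A) (0 < cdeg A v) < \sum_(v in ~: A) cdeg A v)%N; last by rewrite E1 E2 lE ltnn.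
  rewrite (bigD1 v2) ?inE //= [ltnRHS](bigD1 v2) ?inE //= d2.
  by rewrite -addSn leq_add //; apply: leq_sum => v _; case: (cdeg A v).
exists u2; split=> //; last by apply/eqP; rewrite -(eqr_nat R) m'E.
move=> u v uA vA uv.
have cuv : cross A u v by rewrite /cross uv uA (negPf vA).
(* All of [T] is visible from [v2], so every vertex of [A] with positive cross weight is a neighbour
   of [v2], which has only one in [A]. *)
have cu : cross A v2 u.
  apply/negPn/negP=> ncu; have /eqP := subA v2 v2A; rewrite cE d2 mulr1.
  rewrite -[X in _ == X]addr0 (inj_eq (addrI T)) (bigD1 u) ?uA ?ncu //= gt_eqF //.
  by rewrite ltr_pwDl ?(cw_pos u v cuv) ?sumr_ge0.
move/card_le1P: d1 => d1.
have cu2 : cross A v2 u2 by rewrite /cross adj_sym uv2 u2A (negPf v2A).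
by have := d1 u2; rewrite inE => /(_ cu2) /(_ u); rewrite inE cu => /esym/eqP.
Qed.

(** * Crossing edges of a partition *)

Local Open Scope nat_scope.

Section Counting.
Variable G : sgraph.
Implicit Types (F X : {set {set G}}) (A : {set G}) (x y u v w : G).
Local Notation cn F := (connect (edge_rel F)).
Local Notation rt F := (fingraph.root (edge_rel F)).

Lemma handshake X : X \subset edges G ->
  2 * #|X| = \sum_x #|[set y | [set x; y] \in X]|.
Proof.
move=> sX; have star x : #|[set y | [set x; y] \in X]| = \sum_(e in X | x \in e) 1.
  have inj : {in [set y | [set x; y] \in X] &, injective (fun y => [set x; y])}.
    move=> y z yX zX /set2_eq[] [] // E1 E2.
    by rewrite E2 E1.
  rewrite -(card_in_imset inj) -sum1_card; apply: eq_bigl => e.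
  apply/imsetP/andP => [[y yX ->]|[eX xe]]; first by move: yX; rewrite inE set21.
  have [a [b [Ee ab]]] := edgesP sX eX.
  move: xe; rewrite Ee !inE => /orP[] /eqP->; first by exists b; rewrite // inE -Ee.
  by exists a; rewrite ?inE setUC // -Ee.
rewrite (eq_bigr _ (fun x _ => star x)) (exchange_big_dep (mem X)) /= => [|x e _ /andP[]//].
rewrite mulnC -sum_nat_const; apply: eq_bigr => e eX.
have [a [b [Ee ab]]] := edgesP sX eX.
rewrite (eq_bigl (mem e)) => [|x]; last by rewrite /= eX.
by rewrite sum1_card Ee cards2 adj_neq.
Qed.

Lemma comps_gt0 F x : 0 < comps F.
Proof. by apply/card_gt0P; exists (rt F x); apply: imset_f. Qed.

Lemma comps1_connect F x y : comps F <= 1 -> cn F x y.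
Proof.
move=> c1; rewrite -same_root; apply/eqP.
by move/card_le1_eqP: c1; apply; apply: imset_f.
Qed.

Lemma card_component_edges F x : F \subset edges G ->
  #|[set y | cn F x y]| <= #|component_edges F x| + 1.
Proof.
move=> sF; set U := [set y | _]; set F' := component_edges F x.
have sF' : F' \subset edges G.
  by apply: subset_trans sF; apply/subsetP=> e; rewrite inE => /andP[].
have xU y : y \in U -> cn F' x y.
  rewrite inE => /connectP[p]; elim/last_ind: p y => [|p b IHp] y /=; first by move=> _ ->.
  rewrite rcons_path last_rcons => /andP[pth ab] ->.
  have xa : cn F x (last x p) by apply/connectP; exists p.
  apply: connect_trans (IHp _ pth erefl) (connect1 _).
  rewrite /edge_rel inE; move: (ab); rewrite /edge_rel => ->; rewrite subUset !sub1set !inE xa /=.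
  exact: connect_trans xa (connect1 ab).
have cF' : comps F' <= #|~: U| + 1.
  apply: (@leq_trans #|rt F' x |: (rt F' @: (~: U))|).
    apply/subset_leq_card/subsetP=> _ /imsetP[y _ ->].
    have [yU|yU] := boolP (y \in U); rewrite inE; last by rewrite imset_f ?orbT // inE.
    by rewrite inE same_root cn_sym xU.
  by rewrite addnC (leq_trans (leq_card_setU _ _)) // cards1 leq_add2l leq_imset_card.
by have := card_le_comps sF'; have := cardsC U; lia.
Qed.

(** * Lower bounds for the edges between the classes of a partition *)

Section Partition.
Variable E0 : {set {set G}}.
Let cls x := [set y | rt E0 y == rt E0 x].
Let X := [set e in edges G | [exists x, exists y, (e == [set x; y]) && ~~ cn E0 x y]].
Let Rs := rt E0 @: [set: G].

Let in_cls x y : (y \in cls x) = cn E0 y x.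
Proof. by rewrite inE same_root. Qed.

Let memX x y : ([set x; y] \in X) = adj x y && ~~ cn E0 x y.
Proof.
rewrite inE mem_edges; congr (_ && _).
apply/existsP/idP => [[a /existsP[b /andP[/eqP/set2_eq[] [-> ->]]]]|nxy] //.
  by rewrite cn_sym.
by exists x; apply/existsP; exists y; rewrite eqxx.
Qed.

Lemma crossing_cdeg : 2 * #|X| = \sum_x cdeg (cls x) x.
Proof.
rewrite handshake; last by apply/subsetP=> e; rewrite inE => /andP[].
apply: eq_bigr => x _; apply: eq_card => y; rewrite in_set memX [RHS]in_set /cross; congr (_ && _).
by rewrite !in_cls connect0 cn_sym; case: connect.
Qed.

Lemma crossing_cut_size : 2 * #|X| = \sum_(r in Rs) cut_size [set y | rt E0 y == r].
Proof.
rewrite crossing_cdeg (eq_bigl (mem [set: G])) => [|x]; last by rewrite /= inE.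
rewrite (partition_big_imset (rt E0)) /=; apply: eq_bigr => r _.
rewrite /cut_size; apply: eq_big => [x|x /andP[_ /eqP <-] //]; by rewrite !inE.
Qed.

(** A vertex of [A] has at least [d + 1 - a] neighbours outside, where [a] is the size of [A], and
    [a * (d + 1 - a) >= d] for [1 <= a <= d], with equality at both ends. *)
Lemma small_cut_size (d : nat) A : (forall u : G, d <= degree u) -> 0 < #|A| -> #|A| <= d ->
  d <= cut_size A.
Proof.
move=> hd A0 Ad.
have H u : u \in A -> d + 1 <= #|A| + cdeg A u.
  move=> uA; have -> : cdeg A u = #|[set v | adj u v] :\: A|.
    by apply: eq_card => v; rewrite !inE /cross uA; case: (v \in A); rewrite ?andbF ?andbT.
  have := hd u; rewrite /degree -(cardsID A).
  have : #|[set v | adj u v] :&: A| <= #|A :\ u|.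
    apply/subset_leq_card/subsetP=> v; rewrite !inE => /andP[uv ->].
    by rewrite eq_sym adj_neq.
  by have := cardsD1 u A; rewrite uA; lia.
have : \sum_(u in A) (d + 1) <= \sum_(u in A) (#|A| + cdeg A u) by apply: leq_sum.
rewrite sum_nat_const big_split /= sum_nat_const -/(cut_size A).
move: A0 Ad; case: #|A| => // a _ /subnKC <-; move: (d - _) (cut_size A) => e c.
nia.
Qed.

(** All of the [t] classes but at most one are left by [d >= 2 * K] edges, so twice the crossing
    edges number at least [2 * K * (t - 1)]. *)
Lemma few_large_classes (d K : nat) : (forall u : G, d <= degree u) -> 2 * K <= d ->
  (forall x y, d < #|cls x| -> d < #|cls y| -> cn E0 x y) ->
  K * comps E0 <= #|X| + K.
Proof.
move=> hd Kd hl; rewrite -(leq_pmul2l (ltn0Sn 1)) mulnDr crossing_cut_size.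
have small r : r \in Rs -> #|[set y | rt E0 y == r]| <= d -> d <= cut_size [set y | rt E0 y == r].
  move=> /imsetP[x _ ->]; apply: small_cut_size => //.
  by apply/card_gt0P; exists x; rewrite inE.
have bound (B : {set G}) : B \subset Rs ->
    (forall r, r \in B -> #|[set y | rt E0 y == r]| <= d) ->
    #|B| * d <= \sum_(r in Rs) cut_size [set y | rt E0 y == r].
  move=> sB hB; rewrite [leqRHS](big_setID B) /= (setIidPr sB) -sum_nat_const.
  apply: leq_trans (leq_addr _ _); apply: leq_sum => r rB.
  by apply: small (hB r rB); apply: (subsetP sB).
case: (pickP [pred r in Rs | d < #|[set y | rt E0 y == r]|]) => [r /= /andP[rR lr]|none].
  have : #|Rs :\ r| * d <= \sum_(r in Rs) cut_size [set y | rt E0 y == r].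
    apply: bound; first exact: subsetDl.
    move=> r'; rewrite !inE => /andP[ne r'R]; rewrite leqNgt; apply/negP=> lr'.
    case/imsetP: rR lr ne => x _ -> lx; case/imsetP: r'R lr' => y _ -> ly /negP[].
    by rewrite same_root; apply: hl.
  have := cardsD1 r Rs; rewrite rR /comps -/Rs => -> H; nia.
have : #|Rs| * d <= \sum_(r in Rs) cut_size [set y | rt E0 y == r].
  by apply: bound => // r rR; have := none r; rewrite /= rR /= => /negbT; rewrite -leqNgt.
by rewrite /comps -/Rs => H; nia.
Qed.

(** The degree sum is at least that of disjoint cliques on [d + 1] and [n - d - 1] vertices. Two
    classes with more than [d] vertices each and [c] further vertices cannot hold that many edges
    internally, even if the [c] vertices are lumped together. *)
Lemma two_large_classes (d K : nat) (a b : G) : 2 * K <= d ->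
  ~~ cn E0 a b -> d < #|cls a| -> d < #|cls b| -> 2 < comps E0 ->
  (d + 1) * d + (#|G| - d - 1) * (#|G| - d - 2) <= \sum_(u : G) degree u ->
  K * comps E0 <= #|X| + K.
Proof.
move=> Kd nab la lb c3 hdeg.
have dis : cls a :&: cls b = set0.
  apply/setP=> v; rewrite inE !in_cls inE; apply/negP=> /andP[va vb].
  by case/negP: nab; apply: connect_trans vb; rewrite cn_sym.
pose C := ~: (cls a :|: cls b).
have nE : #|G| = #|cls a| + #|cls b| + #|C|.
  by rewrite -(cardsC (cls a :|: cls b)) cardsU dis cards0 subn0.
have cC : comps E0 <= #|C| + 2.
  apply: (@leq_trans #|[set rt E0 a; rt E0 b] :|: (rt E0 @: C)|).
    apply/subset_leq_card/subsetP=> _ /imsetP[v _ ->].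
    have [vC|] := boolP (v \in C); first by rewrite inE imset_f ?orbT.
    by rewrite !inE negbK => /orP[] ->; rewrite ?orbT.
  rewrite (leq_trans (leq_card_setU _ _)) // addnC leq_add ?leq_imset_card //.
  by rewrite cards2; case: (_ == _).
have degE u : degree u + 1 <= cdeg (cls u) u + #|cls u|.
  have uu : u \in cls u by rewrite in_cls.
  have -> : cdeg (cls u) u = #|[set v | adj u v] :\: cls u|.
    apply: eq_card => v; rewrite in_set in_setD in_set /cross uu.
    by case: (v \in cls u); rewrite ?andbF ?andbT.
  rewrite /degree -(cardsID (cls u)) [in leqRHS](cardsD1 u (cls u)) uu.
  have : #|[set v | adj u v] :&: cls u| <= #|cls u :\ u|.
    apply/subset_leq_card/subsetP=> v; rewrite in_setI in_setD1 in_set => /andP[uv ->].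
    by rewrite eq_sym adj_neq.
  lia.
have S1 : \sum_(u : G) degree u + #|G| <= 2 * #|X| + \sum_u #|cls u|.
  rewrite crossing_cdeg -big_split /= -sum1_card -big_split /=.
  by apply: leq_sum => u _; apply: degE.
have clsE u w : cn E0 u w -> #|cls u| = #|cls w|.
  by rewrite -same_root => /eqP E; apply: eq_card => v; rewrite !in_set E.
have S2 : \sum_u #|cls u| <= #|cls a| * #|cls a| + #|cls b| * #|cls b| + #|C| * #|C|.
  rewrite (bigID (mem (cls a))) /= -addnA leq_add //.
    rewrite -sum_nat_const; apply: leq_sum => u; rewrite in_cls => /clsE-> //.
  rewrite (bigID (mem (cls b))) /= leq_add //.
    rewrite -sum_nat_const [leqLHS]big_mkcond [leqRHS]big_mkcond; apply: leq_sum => u _.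
    case ub: (u \in cls b); rewrite ?andbF // andbT; case: ifP => // _.
    by rewrite (@clsE u b) // -in_cls.
  rewrite -sum_nat_const [leqLHS]big_mkcond [leqRHS]big_mkcond; apply: leq_sum => u _.
  rewrite /C in_setC in_setU negb_or; case: ifP => // /andP[ua ub].
  apply/subset_leq_card/subsetP=> v; rewrite in_cls in_setC in_setU negb_or !in_cls => vu.
  rewrite !in_cls in ua ub; apply/andP; split.
    by apply: contra ua; apply: connect_trans; rewrite cn_sym.
  by apply: contra ub; apply: connect_trans; rewrite cn_sym.
move: la lb nE cC S1 S2 hdeg.
move: (\sum_u #|cls u|) (\sum_(u : G) degree u) #|cls a| #|cls b| #|C| => S Dg p q c.
move=> la lb -> cC S1 S2 hdeg.
have [p' pE] : exists p', p = d + 1 + p' by exists (p - (d + 1)); lia.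
have [q' qE] : exists q', q = d + 1 + q' by exists (q - (d + 1)); lia.
have : K * comps E0 <= K * (c + 2) by rewrite leq_mul2l cC orbT.
subst p q.
have e1 : d + 1 + p' + (d + 1 + q') + c - d - 1 = d + 1 + p' + q' + c by lia.
have e2 : d + 1 + p' + (d + 1 + q') + c - d - 2 = d + p' + q' + c by lia.
rewrite e1 e2 in hdeg.
have c1 : 1 <= c by lia.
have Kc : 2 * K * (c + 1) <= d * (c + 1) by rewrite leq_mul2r Kd orbT.
have dc : d <= d * c by rewrite leq_pmulr.
(* This gives at least [(d + 1) * c] crossing edges; there are at most [c + 2] classes, and
   [c >= 1]. *)
have key : (d + 1) * d + (d + 1 + p' + q' + c) * (d + p' + q' + c) +
    (d + 1 + p' + (d + 1 + q') + c) = (d + 1 + p') * (d + 1 + p') +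
    (d + 1 + q') * (d + 1 + q') + c * c + 2 * (d + 1) * c +
    2 * (p' * q' + p' * c + q' * c) by ring.
lia.
Qed.

End Partition.
End Counting.

Lemma min_degree_le (G : sgraph) (u : G) : min_degree G <= degree u.
Proof.
rewrite /min_degree; have := mem_index_enum u.
elim: (index_enum _) => // v r IHr; rewrite inE big_cons geq_min.
by case/predU1P=> [<-|/IHr->]; rewrite ?leqnn ?orbT.
Qed.

(** * From nearly full forests to property P *)

Lemma all_but_one_full (K N : nat) (c : 'I_K.+1 -> nat) :
  0 < N -> (forall i, c i <= N - 1) -> K.+1 * N <= \sum_i c i + K.+1 + 1 ->
  exists2 i0, forall i, i != i0 -> c i = N - 1 & N - 2 <= c i0.
Proof.
move=> N0 leN hsum.
have hdef : \sum_i (N - 1 - c i) <= 1.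
  have : \sum_i (N - 1 - c i) + \sum_i c i = K.+1 * (N - 1).
    rewrite -big_split /= (eq_bigr (fun=> N - 1)) ?sum_nat_const ?card_ord // => i _.
    by rewrite subnK.
  nia.
case: (pickP [pred i | c i < N - 1]) => [i0 /= lt0|full].
  move: hdef; rewrite (bigD1 i0) //= => hdef.
  exists i0 => [i ne|]; last by lia.
  have : \sum_(j < K.+1 | j != i0) (N - 1 - c j) == 0.
    by move: hdef; move: (\sum_(_ < _ | _) _) => S; lia.
  rewrite sum_nat_eq0 => /forallP/(_ i)/implyP/(_ ne) /eqP.
  by have := leN i; lia.
exists ord0 => [i _|]; first by have := full i; have := leN i; rewrite /=; lia.
by have := full ord0; rewrite /=; lia.
Qed.

(** The one forest that may lack an edge becomes [F]. Its [n - 2] edges suffice since [n - 1 > d],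
    and two components of at most [d] vertices could not cover more than [2 * d + 2] vertices. *)
Lemma property_P_of_forests (G : sgraph) (k d : nat) (T : 'I_k.+1 -> {set {set G}}) :
  0 < d -> 2 * d + 2 < #|G| ->
  (forall i, is_forest (T i)) -> (forall i j, i != j -> [disjoint T i & T j]) ->
  k.+1 * #|G| <= \sum_i #|T i| + k.+1 + 1 -> property_P k d G.
Proof.
move=> d0 dn fT dT hsum.
have n0 : 0 < #|G| by lia.
have [x0 _] := card_gt0P n0.
have cT i : #|T i| + comps (T i) = #|G| := card_forest (fT i).
have leT i : #|T i| <= #|G| - 1 by have := cT i; have := comps_gt0 (T i) x0; lia.
have [i0 hi0 h0] := all_but_one_full n0 leT hsum.
exists (fun i => T (lift i0 i)), (T i0); split.
  move=> i; split=> // x y; apply: comps1_connect.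
  by have := cT (lift i0 i); rewrite hi0 ?lift_eqF // 1?eq_sym ?neq_lift //; lia.
split; first by move=> i j ij; apply: dT; rewrite (inj_eq lift_inj).
split=> //; split; first by move=> i; apply/dT/neq_lift.
split.
  have h1 : (#|G|%:R - 2 <= #|T i0|%:R :> rat)%R.
    rewrite lerBlDr -natrD ler_nat; lia.
  have h2 : (2 * d%:R + 2 < #|G|%:R :> rat)%R by rewrite -natrM -natrD ltr_nat.
  have h3 : (0 < d%:R :> rat)%R by rewrite ltr0n.
  apply: lt_le_trans h1; rewrite -(ltr_pM2r h3).
  have -> : ((d%:R - 1) / d%:R * (#|G|%:R - 1) * d%:R = (d%:R - 1) * (#|G|%:R - 1) :> rat)%R.
    by field; rewrite gt_eqF.
  lra.
move=> _; have [sF _] := fT i0.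
have c2 : comps (T i0) <= 2 by have := cT i0; lia.
have [x hx] : exists x, d < #|[set y | connect (edge_rel (T i0)) x y]|.
  apply/existsP; apply: contraT => /existsPn small.
  have : #|G| <= comps (T i0) * d.
    rewrite -cardsT -sum1_card.
    rewrite (partition_big_imset (fingraph.root (edge_rel (T i0)))) /= -sum_nat_const.
    apply: leq_sum => r /imsetP[x _ ->].
    apply: leq_trans (_ : #|[set y | connect (edge_rel (T i0)) x y]| <= d).
      rewrite -sum1_card [leqLHS]big_mkcond [leqRHS]big_mkcond; apply: leq_sum => y _.
      by rewrite !inE same_root cn_sym.
    by have := small x; rewrite -leqNgt.
  have : comps (T i0) * d <= 2 * d by rewrite leq_mul2r c2 orbT.
  lia.
exists x; have := card_component_edges x sF; lia.
Qed.

(** * Consequences of the spectral hypothesis *)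

Section MainBound.
Variables (R : realType) (G : sgraph) (k d : nat).
Hypotheses (k0 : 0 < k) (kd : 2 * k + 2 <= d) (dn : 2 * d + 3 <= #|G|).
Hypothesis hdeg : forall u : G, d <= degree u.
Hypothesis hlam : (lambda R 1 (B_graph #|G| (d + 1) (k - 1)) <= lambda R 1 G)%R.

Let s := d + 1.
Let m := k - 1.

(** From here on the spectral radius of the extremal graph is represented by [r - 1]. *)
Let rho_exists : exists r : R, [/\ ((#|G| - s)%:R <= r)%R,
  ((r - (#|G| - s)%:R) * (r ^+ 2 * (r - s%:R) - m%:R * (r - s%:R + 1)) =
    m%:R ^+ 2 * (r - s%:R + 1))%R & (r - 1 <= lambda R 1 G)%R].
Proof.
have sb : s < #|G| - s by rewrite /s; lia.
have mb : 2 * m + 2 <= #|G| - s by rewrite /s /m; lia.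
have [r [r1 _ hr]] := star_root R sb mb.
exists r; split=> //; apply: le_trans hlam.
by apply: B_lambda1 hr => //; rewrite /s /m; lia.
Qed.

Let lam_low : ((#|G| - d - 2)%:R <= lambda R 1 G)%R.
Proof.
have [r [r1 _ r2]] := rho_exists; apply: le_trans r2; rewrite lerBrDr.
by apply: le_trans r1; rewrite natr1 ler_nat /s; lia.
Qed.

Let lam_gt0 : (0 < lambda R 1 G)%R.
Proof. by apply: lt_le_trans lam_low; rewrite ltr0n; lia. Qed.

(** At [lam = n - d - 2] the Hong-Shu-Fang bound is exactly the degree sum of disjoint cliques on
    [d + 1] and [n - d - 1] vertices. *)
Lemma degree_sum_lower :
  (d + 1) * d + (#|G| - d - 1) * (#|G| - d - 2) <= \sum_(u : G) degree u.
Proof.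
have [x [x0 xn0 xs]] := lambda1_subeigenvector lam_gt0.
have d0 : 0 < d by lia.
have := hong_shu_fang x0 xn0 xs d0 hdeg (ltW lam_gt0).
set D := \sum_u degree u; move: dn lam_low; set n := #|G| => dn' lo.
have [c nE] : exists c, n = 2 * d + 3 + c by exists (n - (2 * d + 3)); lia.
have mE : n - d - 2 = d + 1 + c by lia.
rewrite mE in lo => H.
have : ((d + 1 + c)%:R * (c + 2)%:R <= D%:R - d%:R * (n%:R - 1) :> R)%R.
  apply: le_trans H; apply: ler_pM => //; try exact: ler0n.
  by move: lo; rewrite !natrD; lra.
rewrite lerBrDr => H2.
have : (d + 1 + c) * (c + 2) + d * (n - 1) <= D.
  rewrite -(ler_nat R) natrD natrM natrM natrB //; lia.
rewrite nE; have -> : 2 * d + 3 + c - d - 1 = d + 2 + c by lia.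
have -> : 2 * d + 3 + c - d - 2 = d + 1 + c by lia.
have -> : 2 * d + 3 + c - 1 = 2 * d + 2 + c by lia.
nia.
Qed.

Lemma cut_lower (A : {set G}) : s <= #|A| -> s <= #|~: A| ->
  ~ isomorphic G (B_graph #|G| (d + 1) (k - 1)) -> k <= cut_size A.
Proof.
wlog AA : A / #|A| <= #|~: A| => [H sA sA'|sA _ niso].
  have [le|/ltnW le] := leqP #|A| #|~: A|; first exact: H.
  by have := H (~: A); rewrite setCK cut_sizeC; apply.
rewrite leqNgt; apply/negP=> cm.
have cA := cardsC A.
have [x [x0 xn0 xs]] := lambda1_subeigenvector lam_gt0.
have [AE|Alt] := leqP #|A| s; last first.
  have : (lambda R 1 G < (#|G| - d - 2)%:R)%R.
    by apply: (balanced_cut x0 xn0 xs (A := A)); rewrite /s in sA AA Alt *; lia.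
  by rewrite ltNge lam_low.
have {AE sA} AE : #|A| = s by apply/eqP; rewrite eqn_leq AE sA.
have AE' : #|~: A| = #|G| - s by lia.
have [r [r1 hr r2]] := rho_exists.
rewrite -AE' -AE in r1 hr.
have [|||||u0 [u0A st cmE cl]] := @star_extremal R G A m r _ x x0 xn0 xs _ _ _ _ _ r1 hr r2.
- by rewrite AE /s; lia.
- by rewrite AE AE' /s; lia.
- by rewrite AE' /s /m; lia.
- by move=> u; rewrite AE /s addn1 ltnS.
- by rewrite /m; lia.
apply: niso; have := star_isomorphic st u0A cl.
by rewrite AE cmE.
Qed.

(** The final [+ 1], the edge that [F] may lack, is spent only on a partition into two large
    classes, where [k] crossing edges are just enough. *)
Lemma crossing_lower (E0 : {set {set G}}) :
  ~ isomorphic G (B_graph #|G| (d + 1) (k - 1)) ->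
  k.+1 * comps E0 <= #|[set e in edges G | [exists x, exists y,
    (e == [set x; y]) && ~~ connect (edge_rel E0) x y]]| + k.+1 + 1.
Proof.
move=> niso; set X := [set e in _ | _].
pose cls x := [set y | fingraph.root (edge_rel E0) y == fingraph.root (edge_rel E0) x].
have [|] := boolP [forall x, forall y, (d < #|cls x|) ==> (d < #|cls y|) ==>
    connect (edge_rel E0) x y].
  move=> /'forall_forallP H.
  have := @few_large_classes G E0 d k.+1 hdeg; rewrite -/X => /(_ _ _) H'.
  apply: leq_trans (H' _ _) _; [lia| |lia] => x y lx ly.
  by move/implyP: (H x y) => /(_ lx)/implyP/(_ ly).
case/forallPn=> a /forallPn[b]; rewrite !negb_imply => /and3P[la lb nab].
have [c3|c2] := ltnP 2 (comps E0).
  have := two_large_classes (K := k.+1) _ nab la lb c3 degree_sum_lower.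
  by rewrite -/X => H; apply: leq_trans (H _) _; lia.
have cC v : v \notin cls a -> v \in cls b.
  rewrite !inE => va; apply/negPn/negP=> vb.
  suff : 2 < comps E0 by rewrite ltnNge c2.
  rewrite /comps; set Rs := _ @: _.
  have -> : 3 = #|fingraph.root (edge_rel E0) v |: [set fingraph.root (edge_rel E0) a;
      fingraph.root (edge_rel E0) b]|.
    by rewrite cardsU1 cards2 !inE negb_or va vb same_root nab.
  by apply/subset_leq_card/subsetP=> z; rewrite !inE => /or3P[] /eqP->; apply: imset_f.
have clsC : cls b = ~: cls a.
  apply/setP=> v; rewrite [RHS]inE; have [va|/cC->//] := boolP (v \in cls a).
  apply/negP=> vb; case/negP: nab; move: va vb; rewrite !inE !same_root cn_sym.
  exact: connect_trans.
have clsE x : cls x = if x \in cls a then cls a else ~: cls a.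
  case: ifP => [|/negbT/cC]; rewrite -?clsC inE => /eqP E; by apply/setP=> v; rewrite !inE E.
have X2 : 2 * #|X| = 2 * cut_size (cls a).
  rewrite crossing_cdeg (bigID (mem (cls a))) /= mul2n -addnn; congr (_ + _).
    by apply: eq_bigr => x xa; rewrite [X in cdeg X](clsE x) xa.
  rewrite -[in RHS]cut_sizeC /cut_size (eq_bigl (fun x => x \in ~: cls a)) => [|x]; last first.
    by rewrite in_setC.
  by apply: eq_bigr => x xa; rewrite [X in cdeg X](clsE x) (negPf (_ : x \notin cls a)) -?in_setC.
have : k <= cut_size (cls a).
  by apply: (cut_lower _ _ niso); rewrite -?clsC /s addn1.
have : k.+1 * comps E0 <= k.+1 * 2 by rewrite leq_mul2l c2 orbT.
lia.
Qed.

End MainBound.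

Local Open Scope ring_scope.

Theorem theorem1p5 (R : realType) (k n delta : nat) (G : sgraph)
  (k_gt0 : (0 < k)%N)
  (mindegG : min_degree G = delta)
  (orderG : #|G| = n)
  (delta_ge : (2 * k + 2 <= delta)%N)
  (n_ge : (2 * delta + 3 <= n)%N)
  (lambda_ge : lambda R 1 (B_graph n (delta + 1) (k - 1)) <= lambda R 1 G) :
  ~ isomorphic G (B_graph n (delta + 1) (k - 1)) -> property_P k delta G.
Proof.
rewrite -orderG in n_ge lambda_ge * => niso.
have hdeg (u : G) : (delta <= degree u)%N by rewrite -mindegG min_degree_le.
have [T [E0 [fT dT hT]]] := forest_packing G k.+1.
apply: (property_P_of_forests _ _ fT dT); [lia|lia|].
have := crossing_lower k_gt0 delta_ge n_ge hdeg lambda_ge E0 niso.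
move: hT; move: (\sum_(_ < _) _)%N #|[set _ in _ | _]| => S X; lia.
Qed.
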